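(* Let $\varphi(k) = k$ and $j \in \mathbb{Z}_{\geq 0}$. Let $\psi_{p}$ be the derivative of the $p$-adic log gamma function on $\mathbb{C}_{p}\setminus\mathbb{Z}_{p}$. Then $$\int_{\mathcal{A}(0,\frac{1}{p}),\varphi}\left(x - \frac{1}{p}\right)^{j}\psi_{p}'(x)\,dx = (-p)^{1 - j}\,j\,L_{p}^{*}(1 - j),$$ where $L_{p}^{*}(s) = \frac{1}{p - 1}\sum_{\chi}L_{p}(s,\chi)$, the sum being over all Dirichlet characters $\chi$ mod $p$.
   Context: $p$ is an odd prime; $\mathbb{C}_p$ is the completion of an algebraic closure of $\mathbb{Q}_p$, with $|p|_p=1/p$. $\mathcal{A}(0,\frac1p)$ is the open disc $\{x\in\mathbb{C}_p:|x-\frac1p|_p<p\}$, regarded as the arc at $b=1/p$ of the circle with center $a=0$ and radius $p$. For $f:\mathcal{A}(a,b)\to\mathbb{C}_p$, the integral with respect to the path sequence $\varphi(k)=k$ is $$\int_{\mathcal{A}(a,b),\varphi}f(x)\,dx=\lim_{k\to\infty}p^{-k}\sum_{\zeta^{p^k}=1}(x-a)f(x),\qquad x=a+(b-a)\zeta,$$ if the limit exists. The $p$-adic log gamma function on $\mathbb{C}_p\setminus\mathbb{Z}_p$ is Diamond's function $G_p(x)=\lim_{k\to\infty}p^{-k}\sum_{n=0}^{p^k-1}\big((x+n)\log(x+n)-(x+n)\big)$, with $\log$ the Iwasawa $p$-adic logarithm, and $\psi_p=G_p'$, i.e. $\psi_p(x)=\lim_{k\to\infty}p^{-k}\sum_{n=0}^{p^k-1}\log(x+n)$.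 $L_p(s,\chi)$ is the Kubota–Leopoldt $p$-adic $L$-function of the Dirichlet character $\chi$, normalized by $L_p(1-n,\chi)=-(1-\chi\omega^{-n}(p)p^{n-1})B_{n,\chi\omega^{-n}}/n$ for integers $n\ge1$, where $\omega$ is the Teichmüller character and $B_{n,\chi}$ are generalized Bernoulli numbers (identically zero for odd $\chi$; for trivial $\chi$ it has a simple pole at $s=1$).
   Formalization: For j = 0 the right-hand side is undefined as written, since L_p(s,χ) for trivial χ has a pole at s = 1; there j L_p^*(1-j) is read as the limit of t L_p^*(1-t) as t tends to 0 in C_p (it equals -1/p). For j ≥ 1 the formula is literal. *)

(* Defs.v *)
From HB Require Import structures.
From mathcomp Require Import all_boot all_order all_algebra.
From mathcomp Require Import all_classical all_reals all_analysis.
Import Order.TTheory GRing.Theory Num.Theory.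
Import numFieldNormedType.Exports.
Set Implicit Arguments.
Unset Strict Implicit.
Unset Printing Implicit Defensive.
Local Open Scope classical_set_scope.
Local Open Scope ring_scope.

(* A p-adic absolute value cannot be a MathComp norm
   (`normrMn` forces it to be archimedean), so K is a plain field carrying a
   function abs : K -> R, and limits in K are limits of distances in R. *)

Section ValuedField.
Variables (R : realType) (K : fieldType) (abs : K -> R).

Definition cvgK (u : nat -> K) (l : K) : Prop :=
  (fun n => abs (u n - l)) @ \oo --> (0 : R).

(* Total limit operators, equal to 0 where there is no limit. *)
Definition limK (u : nat -> K) : K := xget 0 [set l | cvgK u l].

(* Punctured limit: the value f x is irrelevant. *)
Definition fcvgK (f : K -> K) (x l : K) : Prop :=
  forall e : R, 0 < e -> exists2 d : R, 0 < d &
    forall y, y != x -> abs (y - x) < d -> abs (f y - l) < e.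

Definition flimK (f : K -> K) (x : K) : K := xget 0 [set l | fcvgK f x l].

Definition derivK (f : K -> K) (x : K) : K :=
  flimK (fun y => (f y - f x) / (y - x)) x.

Definition cauchyK (u : nat -> K) : Prop :=
  forall e : R, 0 < e -> exists N : nat,
    forall m n : nat, (N <= m)%N -> (N <= n)%N -> abs (u m - u n) < e.

(* Topological closure of the image of Q. *)
Definition Qp : set K :=
  [set x | forall e : R, 0 < e -> exists q : rat, abs (x - ratr q) < e].

Definition Qpbar : set K :=
  [set x | exists P : {poly K}, [/\ P != 0, forall i, Qp P`_i & root P x]].

(* (K, abs) is the completion of an algebraic closure of Q_p.  The first five
   fields force K to have characteristic 0 and abs to restrict to the p-adic
   absolute value on Q; since K is complete, the closure Qp of Q is then the
   field of p-adic numbers.  This determines (K, abs) up to isometry. *)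
Record is_Cp (p : nat) : Prop := IsCp {
  Cp_abs_ge0 : forall x, 0 <= abs x;
  Cp_abs_eq0 : forall x, abs x = 0 <-> x = 0;
  Cp_absM : forall x y, abs (x * y) = abs x * abs y;
  Cp_absD : forall x y, abs (x + y) <= Num.max (abs x) (abs y);
  Cp_absp : abs p%:R = p%:R^-1;
  Cp_complete : forall u, cauchyK u -> exists l, cvgK u l;
  Cp_Qpbar_closed : forall P : {poly K}, (1 < size P)%N ->
    (forall i, Qpbar P`_i) -> exists2 x, Qpbar x & root P x;
  Cp_Qpbar_dense : forall (x : K) (e : R), 0 < e ->
    exists2 y, Qpbar y & abs (x - y) < e
}.

(* The value at 0 is left unspecified. *)
Definition is_iwasawa_log (p : nat) (log : K -> K) : Prop :=
  [/\ forall x y, x != 0 -> y != 0 -> log (x * y) = log x + log y,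
      log p%:R = 0 &
      forall x, abs x < 1 ->
        cvgK (fun n => \sum_(1 <= i < n) (-1) ^+ i.+1 * x ^+ i / i%:R)
             (log (1 + x))].

(* Only meaningful on the open set K \ Z_p; its values on Z_p do not affect
   the derivatives below at points outside Z_p. *)
Definition diamond_logGamma (p : nat) (log : K -> K) (x : K) : K :=
  limK (fun k => (p%:R ^+ k)^-1 *
    \sum_(0 <= n < p ^ k) ((x + n%:R) * log (x + n%:R) - (x + n%:R))).

Definition psi (p : nat) (log : K -> K) : K -> K :=
  derivK (diamond_logGamma p log).

(* The integral of f over the arc at b of the circle with center a, for the
   path sequence phi(k) = k, exists and equals I.  Only the values of f at
   the points a + (b - a) zeta of the arc |x - b| < |b - a| are used. *)
Definition is_arc_integral (p : nat) (a b : K) (f : K -> K) (I : K) : Prop :=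
  cvgK (fun k => (p%:R ^+ k)^-1 *
          \sum_(zeta \in [set z : K | z ^+ (p ^ k) = 1])
             (let x := a + (b - a) * zeta in (x - a) * f x)) I.

End ValuedField.

Section GeneralizedBernoulli.
Variable K : fieldType.

(* gbern f chi n is B_{n,chi}, where
     sum_(a = 1 .. f) chi(a) t e^(a t) / (e^(f t) - 1)
       = sum_(n >= 0) B_{n,chi} t^n / n!,
   computed by power series division (see gbern_gen): gbern_coefs f chi n
   lists B_{i,chi} / i! for i < n. *)
Fixpoint gbern_coefs (f : nat) (chi : nat -> K) (n : nat) : seq K :=
  if n is m.+1 then
    let s := gbern_coefs f chi m in
    rcons s ((f%:R)^-1 *
      (\sum_(1 <= a < f.+1) chi a * (a%:R ^+ m / (m`!)%:R)
       - \sum_(i < m) s`_i * (f%:R ^+ (m - i).+1 / ((m - i).+1`!)%:R)))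
  else [::].

Definition gbern (f : nat) (chi : nat -> K) (n : nat) : K :=
  (n`!)%:R * (gbern_coefs f chi n.+1)`_n.

Lemma size_gbern_coefs f chi n : size (gbern_coefs f chi n) = n.
Proof. by elim: n => //= n IHn; rewrite size_rcons IHn. Qed.

Lemma nth_gbern_coefs f chi n i : (i < n)%N ->
  (gbern_coefs f chi n)`_i = (gbern_coefs f chi i.+1)`_i.
Proof.
elim: n => // n IHn; rewrite ltnS leq_eqVlt => /predU1P[-> // | lt_in].
by rewrite /= nth_rcons size_gbern_coefs lt_in IHn.
Qed.

(* The coefficient of t^n in
     (sum_i B_{i,chi} t^i / i!) ((e^(f t) - 1) / t) = sum_a chi(a) e^(a t). *)
Lemma gbern_gen (f : nat) (chi : nat -> K) (n : nat) :
  f%:R != 0 :> K -> (forall m, (m`!)%:R != 0 :> K) ->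
  \sum_(i < n.+1) gbern f chi i / (i`!)%:R
      * (f%:R ^+ (n - i).+1 / ((n - i).+1`!)%:R)
  = \sum_(1 <= a < f.+1) chi a * (a%:R ^+ n / (n`!)%:R).
Proof.
move=> f0 fact0.
have gE i : gbern f chi i / (i`!)%:R = (gbern_coefs f chi i.+1)`_i.
  by rewrite /gbern mulrAC divff ?mul1r.
rewrite big_ord_recr /= gE subnn expr1 divr1 /= nth_rcons.
rewrite size_gbern_coefs ltnn eqxx mulrAC mulVf // mul1r.
under eq_bigr => i _ do rewrite gE -(nth_gbern_coefs f chi (ltn_ord i)).
by rewrite addrC subrK.
Qed.

End GeneralizedBernoulli.

Section KubotaLeopoldt.
Variables (R : realType) (K : fieldType) (abs : K -> R) (p : nat).

(* Dirichlet characters mod the prime p, with values in K. *)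
Definition dirichlet : set {ffun 'F_p -> K} :=
  [set chi | [/\ chi 0 = 0, chi 1 = 1 &
                 forall a b, chi (a * b) = chi a * chi b]].

Definition principal : {ffun 'F_p -> K} := [ffun a => (a != 0)%:R].

(* As p is prime, a character mod p has conductor 1 if it is principal and p
   otherwise.  Characters in the formulas for L-values are taken primitive,
   so the trivial one takes the value 1 at p. *)
Definition conductor (chi : {ffun 'F_p -> K}) : nat :=
  if chi == principal then 1%N else p.

Definition primitive (chi : {ffun 'F_p -> K}) (a : nat) : K :=
  if chi == principal then 1 else chi a%:R.

Definition is_teichmuller (omega : {ffun 'F_p -> K}) : Prop :=
  dirichlet omega /\
    forall a : nat, ~~ (p %| a)%N -> abs (omega a%:R - a%:R) < 1.

Definition twist (chi omega : {ffun 'F_p -> K}) (n : nat) : {ffun 'F_p -> K} :=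
  [ffun a => chi a * omega a ^- n].

Definition Lp_radius : R := p%:R `^ (1 - (p.-1)%:R^-1).

(* L is the Kubota-Leopoldt L-function of chi: it is meromorphic on the disc
   |s| < p^(1 - 1/(p-1)), with only a simple pole at s = 1 if chi is trivial
   and no pole otherwise, and interpolates the generalized Bernoulli numbers.
   Here c is the residue at 1; L 1 is unspecified for trivial chi. *)
Definition is_Lp (omega chi : {ffun 'F_p -> K}) (L : K -> K) : Prop :=
  (exists (c : K) (u : nat -> K),
     (c != 0 <-> chi = principal) /\
     forall s, abs s < Lp_radius -> s != 1 \/ chi <> principal ->
       cvgK abs (fun n => c / (s - 1) + \sum_(i < n) u i * (s - 1) ^+ i) (L s))
  /\
  (forall n : nat, (0 < n)%N ->
     let xi := twist chi omega n in
     L (1 - n%:R) =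
       - (1 - primitive xi p * p%:R ^+ n.-1)
         * gbern (conductor xi) (primitive xi) n / n%:R).

Definition Lp_star (L : {ffun 'F_p -> K} -> K -> K) (s : K) : K :=
  (p.-1)%:R^-1 * \sum_(chi \in dirichlet) L chi s.

(* j * L_p^*(1 - j).  At j = 0 the simple pole of L_p^* at 1 cancels the zero
   of j, and the product is the value there of the continuous extension of
   t * L_p^*(1 - t). *)
Definition j_Lp_star (L : {ffun 'F_p -> K} -> K -> K) (j : nat) : K :=
  if j is 0%N then flimK abs (fun t => t * Lp_star L (1 - t)) 0
  else j%:R * Lp_star L (1 - j%:R).

End KubotaLeopoldt.

(* Main.v *)
Require Import Defs.
From HB Require Import structures.
From mathcomp Require Import all_boot all_order all_algebra.
From mathcomp Require Import all_classical all_reals all_analysis.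
From mathcomp Require Import ring zify.
From mathcomp Require cyclic finfield.
Import Order.TTheory GRing.Theory Num.Theory.
Import numFieldNormedType.Exports.
Local Open Scope classical_set_scope.
Local Open Scope ring_scope.

(* Both sides equal (-1)^j B_j(1/p).  For |x| > 1 the series
   psi_p'(x) = sum_m (-1)^m B_m x^(-m-1) converges; at x = zeta / p, averaging
   (zeta - 1)^j zeta^(-m) over the p^k-th roots of unity keeps only the
   exponents m = i mod p^k with i <= j, and the terms with m >= p^k vanish
   p-adically, which leaves the expansion of B_j(1/p).  On the other side,
   B_{n,chi} = p^(n-1) sum_a chi(a) B_n(a/p), and orthogonality of the characters
   mod p keeps only a = 1.  For j = 0 the residue of L_p(s, 1) at s = 1 is
   obtained as the limit of (1 - p^(n-1)) B_n along n = (p - 1) p^k. *)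

(** * Bernoulli polynomials *)

(** [psi_p'] is the derivative of a derivative of a limit, so several limits have to be
    interchanged. Expansion in Bernoulli polynomials settles this: averaging over shifts turns a
    power series sum a_i y^i into sum a_i B_i(h), and differentiation in h keeps this shape because
    B_i' = i B_(i-1). One estimate, |B_n| <= p, makes all error terms uniform in the degree, so each
    interchange is an inequality on partial sums passed to the limit. The factor p^(-k) of the arc
    integral has absolute value p^k. It does no harm because |x| = p on the arc, so the tail of the
    series from m = p^k on is of size p^(-p^k) up to a constant. The homogeneous form a^n B_n(b/a)
    keeps both arguments in the unit ball: p^j B_j(1/p) is [bpoly p%:R 1 j]. *)

Section Umbral.
Variable K : fieldType.
Hypothesis charK : forall n, n.+1%:R != 0 :> K.

Lemma fact_neq0 n : n`!%:R != 0 :> K.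
Proof. by rewrite -(prednK (fact_gt0 n)). Qed.

Lemma bin_factE n i : (i <= n)%N ->
  'C(n, i)%:R = n`!%:R / (i`!%:R * (n - i)`!%:R) :> K.
Proof.
move=> le_in; apply: (canRL (mulfK _)); first by rewrite mulf_neq0 ?fact_neq0.
by rewrite -!natrM bin_fact.
Qed.

(** The hypothesis is [gbern_gen] multiplied by (n+1)!. The system is triangular, with the nonzero
    coefficient (n+1) f at [b n], so a closed formula for [gbern] can be proved by checking this
    recurrence. *)
Lemma gbern_unique f (chi b : nat -> K) : (0 < f)%N ->
  (forall n, \sum_(i < n.+1) 'C(n.+1, i)%:R * f%:R ^+ (n - i).+1 * b i
             = n.+1%:R * \sum_(1 <= a < f.+1) chi a * a%:R ^+ n) ->
  gbern f chi =1 b.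
Proof.
move=> f0 bE n; have fK : f%:R != 0 :> K by rewrite -(prednK f0).
elim/ltn_ind: n => n IHn.
have := gbern_gen chi n fK fact_neq0; move: (bE n).
move=> /(congr1 (fun x => x / n.+1`!%:R)).
have -> : n.+1%:R * (\sum_(1 <= a < f.+1) chi a * a%:R ^+ n) / n.+1`!%:R
    = \sum_(1 <= a < f.+1) chi a * (a%:R ^+ n / n`!%:R).
  rewrite factS natrM -mulf_div divff // mul1r mulr_suml.
  by apply: eq_bigr => a _; rewrite mulrA.
move=> <-; rewrite mulr_suml !big_ord_recr /= subnn.
have -> : \sum_(i < n) gbern f chi i / i`!%:R
      * (f%:R ^+ (n - i).+1 / (n - i).+1`!%:R)
   = \sum_(i < n) 'C(n.+1, i)%:R * f%:R ^+ (n - i).+1 * b i / n.+1`!%:R.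
  apply: eq_bigr => -[i /= ltin] _; rewrite IHn //.
  rewrite bin_factE ?(leqW (ltnW ltin)) // subSn ?(ltnW ltin) //.
  by have := (fact_neq0 n.+1, fact_neq0 i, fact_neq0 (n - i).+1);
    move=> [[] *]; field; do ?[apply/andP; split].
move=> /addrI; rewrite binSn expr1 (_ : 1`! = 1)%N // factS natrM divr1.
move=> /(congr1 (fun x => n`!%:R / f%:R * x)).
have := (fact_neq0 n, charK n); move=> [h1 h2].
set u := gbern _ _ _.
have -> : n`!%:R / f%:R * (u / n`!%:R * f%:R) = u
  by field; apply/andP; split.
move=> ->; move: h1 h2 fK {IHn bE}; move: (n`!%:R : K) (n.+1%:R : K) (f%:R : K).
by move=> A B C *; field; do ![apply/andP; split].
Qed.

(* [gbern 1 (fun=> 1)] follows the convention B_1 = 1/2; here B_1 = -1/2. *)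
Definition bern (n : nat) : K := gbern 1 (fun=> 1) n - (n == 1)%:R.

(** With B_1 = 1/2 the sum is n+1. The correction at index 1 removes 'C(n+1, 1) = n+1, except for n
    = 0, where index 1 is out of range. *)
Lemma sum_bin_bern n : \sum_(i < n.+1) 'C(n.+1, i)%:R * bern i = (n == 0)%:R.
Proof.
have f1 : 1%:R != 0 :> K := charK 0.
have := gbern_gen (fun=> 1) n f1 fact_neq0.
rewrite big_nat1 => /(congr1 (fun x => n.+1`!%:R * x)).
have -> : n.+1`!%:R * (1 * (1%:R ^+ n / n`!%:R)) = n.+1%:R :> K.
  by rewrite mul1r expr1n factS natrM mul1r mulfK ?fact_neq0.
rewrite mulr_sumr => E.
under eq_bigr do rewrite mulrBr.
rewrite sumrB (_ : \sum_(i < n.+1) _ = n.+1%:R); last first.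
  rewrite -E; apply: eq_bigr => -[i /= lein] _.
  rewrite bin_factE ?(ltnW lein) // expr1n subSn //.
  by have := (fact_neq0 n.+1, fact_neq0 i, fact_neq0 (n - i).+1);
    move=> [[] *]; field; do ?[apply/andP; split].
case: n {E} => [|n]; first by rewrite big_ord1 /= mulr0 subr0.
rewrite (bigD1 (@Ordinal n.+2 1 isT)) //= bin1 mulr1 big1 ?addr0 ?subrr //.
by move=> [[|[|i]] lti] //= _; rewrite mulr0.
Qed.

(* The umbral functional 'X^n |-> B_n: identities between Bernoulli polynomials
   become identities between polynomials in 'X, through [umb_shift]. *)
Definition umb (P : {poly K}) : K := \sum_(i < size P) P`_i * bern i.

Lemma umb_widen n (P : {poly K}) : (size P <= n)%N ->
  umb P = \sum_(i < n) P`_i * bern i.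
Proof.
move=> leP; rewrite /umb (big_ord_widen n (fun i => P`_i * bern i)) //.
rewrite [RHS](bigID (fun i : 'I_n => (i < size P)%N)) /= [X in _ + X]big1 ?addr0 //.
by move=> i; rewrite -leqNgt => /(nth_default 0) ->; rewrite mul0r.
Qed.

Lemma umb_is_scalar : scalar umb.
Proof.
move=> a P Q; set n := maxn (size P) (size Q).
have leD : (size (a *: P + Q)%R <= n)%N.
  rewrite (leq_trans (size_polyD _ _)) // geq_max leq_maxr andbT.
  by rewrite (leq_trans (size_scale_leq _ _)) ?leq_maxl.
rewrite (umb_widen n P) ?leq_maxl // (umb_widen n Q) ?leq_maxr // (umb_widen n) //.
rewrite mulr_sumr -big_split; apply: eq_bigr => i _ /=.
by rewrite coefD coefZ mulrDl mulrA.
Qed.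

HB.instance Definition _ :=
  GRing.isLinear.Build K {poly K} K *%R umb umb_is_scalar.

Lemma umbXn n : umb 'X^n = bern n.
Proof.
rewrite /umb size_polyXn big_ord_recr /= coefXn eqxx mul1r big1 ?add0r //.
by move=> i _; rewrite coefXn ltn_eqF // mul0r.
Qed.

(** By linearity P may be a monomial; the top terms B_i then cancel and the rest is the recurrence
    [sum_bin_bern]. *)
Lemma umb_shift (P : {poly K}) : umb (P \Po ('X + 1)) - umb P = P^`().[0].
Proof.
rewrite -[P]coefK poly_def; elim/big_ind: _ => [|Q S IQ IS|i _].
- by rewrite comp_poly0 subrr deriv0 horner0.
- rewrite comp_polyD derivD hornerD !linearD /= -IQ -IS.
  by rewrite opprD addrACA.
rewrite comp_polyZ derivZ hornerZ !linearZ /= -mulrBr; congr (_ * _).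
rewrite comp_Xn_poly derivXn umbXn.
rewrite [X in umb X](_ : _ = \sum_(k < i.+1) 'C(i, k)%:R *: 'X^k); last first.
  rewrite addrC exprDn; apply: eq_bigr => k _.
  by rewrite expr1n mul1r scaler_nat.
rewrite linear_sum big_ord_recr /= binn scale1r umbXn addrK.
case: (i : nat) => [|n]; first by rewrite big_ord0 mulr0n horner0.
under eq_bigr => k _ do rewrite linearZ /= umbXn.
rewrite sum_bin_bern hornerMn hornerXn expr0n.
by case: n => // n; rewrite mul0rn.
Qed.

(* a^n B_n(b / a), without division by a. *)
Definition bpoly (a b : K) (n : nat) : K := umb ((a *: 'X + b%:P) ^+ n).

Lemma bpoly0 a b : bpoly a b 0 = 1.
Proof.
rewrite /bpoly expr0 -(expr0 'X) umbXn; have := sum_bin_bern 0.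
by rewrite big_ord1 bin0 mul1r.
Qed.

Lemma bpolyZ c a b n : bpoly (c * a) (c * b) n = c ^+ n * bpoly a b n.
Proof.
rewrite /bpoly -linearZ /= -exprZn scalerDr scalerA.
by rewrite -[c *: b%:P]mul_polyC -polyCM.
Qed.

Lemma bpolyD a b e n :
  bpoly a (b + e) n = \sum_(i < n.+1) 'C(n, i)%:R * e ^+ i * bpoly a b (n - i).
Proof.
rewrite /bpoly polyCD addrA exprDn linear_sum; apply: eq_bigr => i _ /=.
rewrite -[RHS]linearZ /= mulrC -polyC_exp mul_polyC -scaler_nat scalerA.
by [].
Qed.

Lemma bpoly_bern a b n :
  bpoly a b n = \sum_(i < n.+1) 'C(n, i)%:R * b ^+ i * a ^+ (n - i) * bern (n - i).
Proof.
rewrite -[b]add0r bpolyD add0r; apply: eq_bigr => i _; rewrite -[RHS]mulrA.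
by rewrite /bpoly addr0 exprZn linearZ /= umbXn.
Qed.

Lemma bpoly_diff a b n :
  bpoly a (a + b) n.+1 - bpoly a b n.+1 = n.+1%:R * a * b ^+ n.
Proof.
have := umb_shift ((a *: 'X + b%:P) ^+ n.+1).
rewrite rmorphXn /= comp_polyD comp_polyZ comp_polyX comp_polyC scalerDr.
rewrite alg_polyC -addrA -polyCD /bpoly => ->.
rewrite deriv_exp derivD derivZ derivX derivC addr0 alg_polyC.
by rewrite hornerMn !hornerE -mulr_natl mulrA.
Qed.

Lemma bpolyDr a b e n : bpoly a (b + e) n
  = \sum_(i < n.+1) 'C(n, i)%:R * e ^+ (n - i) * bpoly a b i.
Proof.
rewrite bpolyD (reindex_inj rev_ord_inj); apply: eq_bigr => -[i lei] _ /=.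
by rewrite subSS bin_sub // subKn.
Qed.

(** The recurrence of [gbern_unique] can be checked for each residue a separately, where it is the
    difference equation [bpoly_diff] with step f. *)
Lemma gbern_bpoly f chi n : (0 < f)%N ->
  gbern f chi n = f%:R^-1 * \sum_(1 <= a < f.+1) chi a * bpoly f%:R a%:R n :> K.
Proof.
move=> f0; have fK : f%:R != 0 :> K by rewrite -(prednK f0).
apply: (gbern_unique f chi
  (fun n => f%:R^-1 * \sum_(1 <= a < f.+1) chi a * bpoly f%:R a%:R n)) => // {}n.
transitivity (\sum_(1 <= a < f.+1) chi a * (f%:R^-1 *
    \sum_(i < n.+1) 'C(n.+1, i)%:R * f%:R ^+ (n - i).+1 * bpoly f%:R a%:R i)).
  under [RHS]eq_bigr do rewrite 2!mulr_sumr.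
  rewrite exchange_big; apply: eq_bigr => i _ /=.
  rewrite 2!mulr_sumr; apply: eq_bigr => a _.
  by move: f%:R^-1 => c; ring.
rewrite mulr_sumr; apply: eq_bigr => a _.
have := bpoly_diff f%:R a%:R n; rewrite [f%:R + _]addrC bpolyDr big_ord_recr /=.
rewrite subnn binn expr0 !mul1r addrK => E; rewrite [RHS]mulrCA; congr (_ * _).
apply: (canLR (mulKf fK)); rewrite mulrCA mulrA -E.
by apply: eq_bigr => -[i lti] _ /=; rewrite subSn.
Qed.

Lemma sum_shift_bpoly h N n : (\sum_(k < N) (h + k%:R) ^+ n) * n.+1%:R
  = bpoly 1 (h + N%:R) n.+1 - bpoly 1 h n.+1.
Proof.
elim: N => [|N IHN]; first by rewrite big_ord0 mul0r addr0 subrr.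
rewrite big_ord_recr /= mulrDl IHN; have := bpoly_diff 1 (h + N%:R) n.
rewrite mulr1 addrCA nat1r => /(canRL (subrK _)) ->.
by ring.
Qed.

(** The correction is a polynomial in N without constant term. With N = p^k it shows that the means
    tend to B_n(h); with N = p it bounds B_n by the earlier Bernoulli numbers. *)
Lemma mean_shift_bpoly h N n : N%:R != 0 :> K ->
  N%:R^-1 * \sum_(k < N) (h + k%:R) ^+ n
  = bpoly 1 h n
    + \sum_(i < n) 'C(n, i.+1)%:R * (N%:R ^+ i.+1 / i.+2%:R) * bpoly 1 h (n - i.+1).
Proof.
move=> N0; apply: (mulIf (charK n)); rewrite -mulrA sum_shift_bpoly bpolyD.
rewrite big_ord_recl /= bin0 expr0 subn0 !mul1r [X in X - _]addrC addrK.
rewrite big_ord_recl /= mulrDr mulrDl; congr (_ + _).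
  by rewrite /bump /= bin1 subn1 expr1 /=; field.
rewrite mulr_sumr mulr_suml; apply: eq_bigr => i _; rewrite /bump /= !add1n.
rewrite subSS.
have -> : 'C(n.+1, i.+2)%:R = n.+1%:R * 'C(n, i.+1)%:R / i.+2%:R :> K.
  by apply: (canRL (mulfK _)) => //; rewrite -!natrM mul_bin_diag mulnC.
rewrite exprS; move: N0 (charK i.+1); move: (N%:R : K) (i.+2%:R : K) => A B A0 B0.
by field; rewrite A0 B0.
Qed.

(** The trivial character may be read with any modulus. For modulus p, the term a = p of the
    resulting sum will be the Euler factor's contribution. *)
Lemma gbern1_distribution f n : (0 < f)%N ->
  gbern f (fun=> 1) n = gbern 1 (fun=> 1) n :> K.
Proof.
move=> f0; rewrite (gbern_bpoly 1) // big_nat1 invr1 !mul1r.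
apply: (gbern_unique f _ (bpoly 1%:R 1%:R)) => // {}n.
have := sum_shift_bpoly 1 f n; rewrite bpolyDr big_ord_recr /=.
rewrite subnn binn expr0 !mul1r addrK big_add1 /= big_mkord mulrC => E.
transitivity (\sum_(i < n.+1) 'C(n.+1, i)%:R * f%:R ^+ (n.+1 - i) * bpoly 1 1 i).
  by apply: eq_bigr => -[i lti] _ /=; rewrite subSn.
rewrite -E; congr (_ * _); apply: eq_bigr => i _.
by rewrite mul1r nat1r.
Qed.

End Umbral.

Arguments bern {K} n.
Arguments bpoly {K} a b n.

(** * Limits in C_p *)

Section Cp.
Variables (p : nat) (R : realType) (K : fieldType) (abs : K -> R).
Hypotheses (p_prime : prime p) (KCp : is_Cp abs p).
Implicit Types (x y z : K) (u v : nat -> K).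

Let abs_ge0 := Cp_abs_ge0 KCp.
Let absM := Cp_absM KCp.
Let p_gt0 : (0 : R) < p%:R. Proof. by rewrite ltr0n prime_gt0. Qed.
Let p_gt1 : (1 : R) < p%:R. Proof. by rewrite ltr1n prime_gt1. Qed.

Lemma abs0 : abs 0 = 0.
Proof. by apply/(Cp_abs_eq0 KCp). Qed.

Lemma abs_gt0 x : x != 0 -> 0 < abs x.
Proof.
move=> x0; rewrite lt_neqAle abs_ge0 andbT eq_sym.
by apply: contraNneq x0 => /(Cp_abs_eq0 KCp) ->.
Qed.

Lemma abs1 : abs 1 = 1.
Proof.
apply: (mulIf (lt0r_neq0 (abs_gt0 1 (oner_neq0 K)))).
by rewrite -absM !mul1r.
Qed.

Lemma absN x : abs (- x) = abs x.
Proof.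
have: abs (-1) ^+ 2 = 1 by rewrite expr2 -absM mulrNN mul1r abs1.
move/eqP; rewrite sqrf_eq1 => /orP[/eqP a1|/eqP aN1].
  by rewrite -mulN1r absM a1 mul1r.
by have := abs_ge0 (-1); rewrite aN1 ler0N1.
Qed.

Lemma absX x n : abs (x ^+ n) = abs x ^+ n.
Proof. by elim: n => [|n IHn]; rewrite ?abs1 // !exprS absM IHn. Qed.

Lemma absV x : abs x^-1 = (abs x)^-1.
Proof.
have [->|x0] := eqVneq x 0; first by rewrite invr0 abs0 invr0.
apply: (mulIf (lt0r_neq0 (abs_gt0 x x0))).
by rewrite -absM !mulVf ?abs1 // lt0r_neq0 ?abs_gt0.
Qed.

Lemma absB x y : abs (x - y) = abs (y - x).
Proof. by rewrite -absN opprB. Qed.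

Lemma abs_leD x y (C : R) : abs x <= C -> abs y <= C -> abs (x + y) <= C.
Proof. by move=> xC yC; rewrite (le_trans (Cp_absD KCp x y)) // ge_max xC. Qed.

Lemma abs_ltD x y (C : R) : abs x < C -> abs y < C -> abs (x + y) < C.
Proof. by move=> xC yC; rewrite (le_lt_trans (Cp_absD KCp x y)) // gt_max xC. Qed.

Lemma abs_sum_le I (r : seq I) (P : pred I) (F : I -> K) (C : R) : 0 <= C ->
  (forall i, P i -> abs (F i) <= C) -> abs (\sum_(i <- r | P i) F i) <= C.
Proof.
move=> C0 FC; elim/big_ind: _ => [|x y|i /FC //]; first by rewrite abs0.
exact: abs_leD.
Qed.

Lemma absM_le x y (a b : R) : abs x <= a -> abs y <= b -> abs (x * y) <= a * b.
Proof. by move=> xa yb; rewrite absM ler_pM. Qed.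

Lemma absM_le1 x y (C : R) : abs x <= 1 -> abs y <= C -> abs (x * y) <= C.
Proof. by move=> x1 yC; rewrite -[C]mul1r absM_le. Qed.

Lemma absX_le1 x n : abs x <= 1 -> abs (x ^+ n) <= 1.
Proof. by move=> x1; rewrite absX exprn_ile1. Qed.

Lemma abs_nat_le1 n : abs n%:R <= 1.
Proof.
elim: n => [|n IHn]; first by rewrite abs0.
by rewrite -natr1 abs_leD // abs1.
Qed.

Lemma abs_pX k : abs (p%:R ^+ k) = p%:R ^- k.
Proof. by rewrite absX (Cp_absp KCp) exprVn. Qed.

Lemma abs_p_lt1 : abs p%:R < 1.
Proof. by rewrite (Cp_absp KCp) invf_lt1. Qed.

Lemma abs_dvd_le n k : (p ^ k %| n)%N -> abs n%:R <= p%:R ^- k.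
Proof.
by case/dvdnP=> m ->; rewrite natrM natrX absM abs_pX ler_piMl ?abs_nat_le1.
Qed.

Lemma abs_coprime n : ~~ (p %| n)%N -> abs n%:R = 1.
Proof.
rewrite -prime_coprime // => cpn; apply/eqP; rewrite eq_le abs_nat_le1 leNgt /=.
apply/negP=> n_lt1; have [a b + _] := egcdnP n (prime_gt0 p_prime).
rewrite (eqP cpn : gcdn p n = 1)%N => /(congr1 (fun m => m%:R : K)).
rewrite natrD !natrM => /esym/(canRL (addKr _)) one_eq.
have: abs 1 < 1.
  rewrite -[X in abs X]/(1%:R) one_eq -mulNr; apply: abs_ltD; rewrite absM ?absN.
    by rewrite (le_lt_trans _ n_lt1) // ler_piMl ?abs_nat_le1.
  by rewrite (le_lt_trans _ abs_p_lt1) // ler_piMl ?abs_nat_le1.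
by rewrite abs1 ltxx.
Qed.

Lemma abs_nat_ge n : (0 < n)%N -> n%:R^-1 <= abs n%:R.
Proof.
move=> n0; have [m pm def_n] := pfactor_coprime p_prime n0.
have m0 : (0 < m)%N by move: n0; rewrite def_n muln_gt0 => /andP[].
rewrite {2}def_n natrM natrX absM abs_coprime -?prime_coprime // mul1r abs_pX.
rewrite lef_pV2 ?posrE ?exprn_gt0 ?p_gt0 ?ltr0n // -natrX ler_nat.
by rewrite {2}def_n leq_pmull.
Qed.

Lemma Cp_char0 n : n.+1%:R != 0 :> K.
Proof.
apply/eqP=> n0; have := abs_nat_ge n.+1 isT.
by rewrite n0 abs0 leNgt invr_gt0 ltr0n.
Qed.

Lemma p_neq0 : p%:R != 0 :> K.
Proof. by rewrite -(prednK (prime_gt0 p_prime)) Cp_char0. Qed.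

(** This absorbs the denominators in [mean_shift_bpoly] and in the binomial identities: |n+1| >=
    1/(n+1), and n+1 <= p^n. *)
Lemma abs_pX_div_le1 n : abs (p%:R ^+ n / n.+1%:R) <= 1.
Proof.
rewrite absM absV abs_pX ler_pdivrMr ?abs_gt0 ?Cp_char0 // mul1r.
apply: le_trans (abs_nat_ge n.+1 isT); rewrite lef_pV2 ?posrE ?exprn_gt0 ?p_gt0 ?ltr0n //.
by rewrite -natrX ler_nat ltn_expl ?prime_gt1.
Qed.

Lemma cvgKP u l : cvgK abs u l <->
  forall e : R, 0 < e -> exists N, forall n, (N <= n)%N -> abs (u n - l) < e.
Proof.
split=> [/cvgrPdist_lt ul e e0|ul].
  have [N _ uN] := ul e e0; exists N => n /uN /=.
  by rewrite sub0r normrN ger0_norm.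
apply/cvgrPdist_lt => e e0; have [N uN] := ul e e0; exists N => // n /uN /=.
by rewrite sub0r normrN ger0_norm.
Qed.

Lemma abs_lt_eq0 x : (forall e : R, 0 < e -> abs x < e) -> x = 0.
Proof.
move=> x_lt; apply/eqP; apply: contraT => /abs_gt0 x0.
by have := x_lt _ x0; rewrite ltxx.
Qed.

Lemma cvgK_unique u l1 l2 : cvgK abs u l1 -> cvgK abs u l2 -> l1 = l2.
Proof.
move=> /cvgKP u1 /cvgKP u2; apply/eqP; rewrite -subr_eq0; apply/eqP.
apply: abs_lt_eq0 => e e0; have [N1 uN1] := u1 e e0; have [N2 uN2] := u2 e e0.
rewrite -(subrK (u (maxn N1 N2)) l1) -addrA; apply: abs_ltD.
  by rewrite absB uN1 ?leq_maxl.
by rewrite uN2 ?leq_maxr.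
Qed.

Lemma limKE u l : cvgK abs u l -> limK abs u = l.
Proof.
by move=> ul; apply: (@cvgK_unique u) => //; apply: (xgetPex _ (ex_intro _ l ul)).
Qed.

Lemma cvgK_eventually u v l N : (forall n, (N <= n)%N -> u n = v n) ->
  cvgK abs u l -> cvgK abs v l.
Proof.
move=> uv /cvgKP ul; apply/cvgKP => e /ul[M uM]; exists (maxn N M) => n.
by rewrite geq_max => /andP[/uv <- /uM].
Qed.

Lemma cvgK_cst x : cvgK abs (fun=> x) x.
Proof. by apply/cvgKP => e e0; exists 0 => n _; rewrite subrr abs0. Qed.

Lemma cvgKD u v l m : cvgK abs u l -> cvgK abs v m ->
  cvgK abs (fun n => u n + v n) (l + m).
Proof.
move=> /cvgKP ul /cvgKP vm; apply/cvgKP => e e0.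
have [N1 uN1] := ul e e0; have [N2 vN2] := vm e e0.
exists (maxn N1 N2) => n; rewrite geq_max => /andP[n1 n2].
by rewrite opprD addrACA abs_ltD ?uN1 ?vN2.
Qed.

Lemma cvgKMl x u l : cvgK abs u l -> cvgK abs (fun n => x * u n) (x * l).
Proof.
move=> /cvgKP ul; apply/cvgKP => e e0.
have [->|x0] := eqVneq x 0; first by exists 0 => n _; rewrite !mul0r subrr abs0.
have [|N uN] := ul (e / abs x); first by rewrite divr_gt0 ?abs_gt0.
exists N => n /uN; rewrite -mulrBr absM ltr_pdivlMr ?abs_gt0 //.
by rewrite mulrC.
Qed.

Lemma cvgKB u v l m : cvgK abs u l -> cvgK abs v m ->
  cvgK abs (fun n => u n - v n) (l - m).
Proof.
move=> ul vm; have := cvgKD _ _ _ _ ul (cvgKMl (-1) _ _ vm).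
rewrite mulN1r; apply: (cvgK_eventually _ _ _ 0) => n _.
by rewrite mulN1r.
Qed.

Lemma cvgK_sum I (r : seq I) (F : I -> nat -> K) (l : I -> K) :
  (forall i, cvgK abs (F i) (l i)) ->
  cvgK abs (fun n => \sum_(i <- r) F i n) (\sum_(i <- r) l i).
Proof.
move=> Fl; elim: r => [|i r IHr].
  rewrite big_nil; apply: cvgK_eventually 0 _ (cvgK_cst 0) => n _.
  by rewrite big_nil.
rewrite big_cons; apply: cvgK_eventually 0 _ (cvgKD _ _ _ _ (Fl i) IHr) => n _.
by rewrite big_cons.
Qed.

Lemma cvgK_abs_le u l x (C : R) N : (forall n, (N <= n)%N -> abs (u n - x) <= C) ->
  cvgK abs u l -> abs (l - x) <= C.
Proof.
move=> uC /cvgKP ul; apply/ler_addgt0Pl => e e0; have [M uM] := ul e e0.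
set n := maxn N M; have uCn := uC n (leq_maxl _ _).
have C0 := le_trans (abs_ge0 _) uCn.
have -> : l - x = (l - u n) + (u n - x) by rewrite addrA subrK.
apply: abs_leD; last by rewrite (le_trans uCn) // lerDr ltW.
by rewrite absB (le_trans (ltW (uM n (leq_maxr _ _)))) // lerDl.
Qed.

Lemma cvgK0_bounded u : cvgK abs u 0 -> exists2 C : R, 0 < C & forall n, abs (u n) <= C.
Proof.
move=> /cvgKP /(_ 1 ltr01) [N uN]; exists (1 + \sum_(i < N) abs (u i)).
  by rewrite ltr_wpDr ?sumr_ge0.
move=> n; have [/uN|lt_nN] := leqP N n.
  by rewrite subr0 => /ltW un; rewrite (le_trans un) // lerDl sumr_ge0.
rewrite (bigD1 (Ordinal lt_nN)) //= addrCA lerDl addr_ge0 // sumr_ge0 //.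
Qed.

(** By the ultrametric inequality a block of terms is at most its largest term. [e / 2] recovers a
    strict inequality from the weak one of [abs_sum_le]. *)
Lemma cvgK_series u : cvgK abs u 0 -> exists l, cvgK abs (fun n => \sum_(i < n) u i) l.
Proof.
move=> /cvgKP u0; apply: (Cp_complete KCp) => e e0; have [N uN] := u0 (e / 2) (divr_gt0 e0 (ltr0Sn _ 1)).
exists N.
suff main m n : (N <= m)%N -> (m <= n)%N ->
    abs (\sum_(i < n) u i - \sum_(i < m) u i) < e.
  move=> m n Nm Nn; have [mn|/ltnW nm] := leqP m n; last exact: main.
  by rewrite absB main.
move=> Nm mn; rewrite -!(big_mkord xpredT u) (big_cat_nat (leq0n m) mn) //= [X in X - _]addrC addrK.
apply: (@le_lt_trans _ _ (e / 2)); last by rewrite ltr_pdivrMr // ltr_pMr // ltr1n.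
rewrite big_nat_cond; apply: abs_sum_le => [|i]; first by rewrite ltW // divr_gt0.
rewrite andbT => /andP[mi _]; have := uN i (leq_trans Nm mi).
by rewrite subr0 => /ltW.
Qed.

Lemma cvgK0_le u v (C : R) : 0 <= C -> (forall n, abs (v n) <= C * abs (u n)) ->
  cvgK abs u 0 -> cvgK abs v 0.
Proof.
move=> C0 vu /cvgKP u0; apply/cvgKP => e e0.
have C1 : 0 < C + 1 by rewrite ltr_wpDl.
have [|N uN] := u0 (e / (C + 1)); first by rewrite divr_gt0.
exists N => n /uN; rewrite !subr0 ltr_pdivlMr // => un.
rewrite (le_lt_trans (vu n)) // (le_lt_trans _ un) // mulrC ler_wpM2l // lerDl //.
Qed.

Lemma cvgK_pX : cvgK abs (fun k => p%:R ^+ k) 0.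
Proof.
apply/cvgKP => e e0.
have := @cvg_geometric R 1 p%:R^-1; rewrite ger0_norm ?invr_ge0 // invf_lt1 //.
move=> /(_ p_gt1) /cvgrPdist_lt /(_ e e0) [N _ cN]; exists N => n /cN /=.
rewrite sub0r normrN /geometric /= mul1r ger0_norm ?exprn_ge0 ?invr_ge0 //.
by rewrite subr0 abs_pX exprVn.
Qed.

Lemma cvgK_shift m u l : cvgK abs (fun n => u (n + m)%N) l <-> cvgK abs u l.
Proof.
split=> /cvgKP ul; apply/cvgKP => e /ul[N uN]; last first.
  by exists N => n Nn; rewrite uN // (leq_trans Nn) ?leq_addr.
exists (N + m)%N => n Nn; have le_mn := leq_trans (leq_addl N m) Nn.
by rewrite -(subnK le_mn) uN // leq_subRL // addnC.
Qed.

Lemma cvgKBP u l : cvgK abs u l <-> cvgK abs (fun n => u n - l) 0.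
Proof.
by split=> /cvgKP ul; apply/cvgKP => e /ul[N uN]; exists N => n /uN; rewrite subr0.
Qed.

(** Uniqueness of a punctured limit needs points other than x arbitrarily close to x; the points x +
    p^N serve. *)
Lemma flimKE (f : K -> K) x l : fcvgK abs f x l -> flimK abs f x = l.
Proof.
move=> fl; have fl' : fcvgK abs f x (flimK abs f x) by apply: (xgetPex _ (ex_intro _ l fl)).
apply/eqP; rewrite -subr_eq0; apply/eqP; apply: abs_lt_eq0 => e e0.
have [d d0 fd] := fl e e0; have [d' d'0 fd'] := fl' e e0.
have [|N pN] := (cvgKP _ _).1 cvgK_pX (Num.min d d'); first by rewrite lt_min d0.
have := pN N (leqnn N); rewrite subr0 lt_min => /andP[pd pd'].
set y := x + p%:R ^+ N.
have yx : y != x by rewrite -subr_eq0 addrAC subrr add0r expf_neq0 ?p_neq0.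
have {}yE : y - x = p%:R ^+ N by rewrite addrAC subrr add0r.
rewrite -(subrK (f y) (flimK abs f x)) -addrA; apply: abs_ltD.
  by rewrite absB fd' // yE.
by rewrite fd // yE.
Qed.

Lemma derivKE (f : K -> K) x l : fcvgK abs (fun y => (f y - f x) / (y - x)) x l ->
  derivK abs f x = l.
Proof. by move=> fl; apply: flimKE. Qed.

(** * Volkenborn integrals of power series *)

Lemma bpoly10 n : bpoly 1 0 n = bern n :> K.
Proof. by rewrite /bpoly scale1r addr0 umbXn. Qed.

(** A weak form of the von Staudt-Clausen theorem. For h = 0 and N = p, [mean_shift_bpoly] writes
    B_n as 1/p times an integer, minus a combination of earlier B_i with coefficients in the unit
    ball. *)
Lemma abs_bern_le n : abs (bern n) <= p%:R.
Proof.
elim/ltn_ind: n => n IHn.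
have := mean_shift_bpoly K Cp_char0 0 p n p_neq0.
rewrite bpoly10 => /esym/(canRL (addrK _)) ->.
apply: abs_leD; rewrite ?absN.
  rewrite absM absV (Cp_absp KCp) invrK ler_piMr // abs_sum_le // => k _.
  by rewrite add0r absX_le1 // abs_nat_le1.
apply: abs_sum_le => // i _; rewrite bpoly10.
apply: absM_le1; last by rewrite IHn // ltn_subrL (leq_ltn_trans _ (ltn_ord i)).
by rewrite absM_le1 ?abs_nat_le1 ?abs_pX_div_le1.
Qed.

Lemma abs_bpoly_le a b n : abs a <= 1 -> abs b <= 1 -> abs (bpoly a b n) <= p%:R.
Proof.
move=> a1 b1; rewrite bpoly_bern; apply: abs_sum_le => // i _.
by rewrite !absM_le1 ?abs_bern_le ?abs_nat_le1 ?absX_le1.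
Qed.

(* The bound is uniform in n, so that limits of p^(-k) sum_(m < p^k) can be
   taken termwise in power series. *)
Lemma abs_mean_shift_le k h n : abs h <= 1 ->
  abs (p%:R ^- k.+1 * (\sum_(0 <= m < p ^ k.+1) (h + m%:R) ^+ n) - bpoly 1 h n)
  <= p%:R * p%:R ^- k.
Proof.
move=> h1; have pk0 : (p ^ k.+1)%:R != 0 :> K by rewrite natrX expf_neq0 ?p_neq0.
have := mean_shift_bpoly K Cp_char0 h (p ^ k.+1) n pk0.
rewrite big_mkord natrX [bpoly 1 h n + _]addrC => ->; rewrite addrK.
apply: abs_sum_le => [|i _]; first by rewrite mulr_ge0 ?invr_ge0 ?exprn_ge0 // ltW.
rewrite [leRHS]mulrC; apply: absM_le; last by rewrite abs_bpoly_le ?abs1.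
apply: absM_le1; first exact: abs_nat_le1.
rewrite -exprM -natrX.
(* The factor p^(i+1) absorbs the denominator i+2, and p^(k(i+1)) still leaves p^(-k). *)
have -> : (p ^ (k.+1 * i.+1) = p ^ (k * i.+1) * p ^ i.+1)%N by rewrite -expnD mulSn addnC.
rewrite natrM -mulrA mulrC; apply: absM_le1; first by rewrite natrX abs_pX_div_le1.
by apply: abs_dvd_le; rewrite dvdn_exp2l // leq_pmulr.
Qed.

Lemma cvgK_bpoly_series (a : nat -> K) h : cvgK abs a 0 -> abs h <= 1 ->
  exists v : K, cvgK abs (fun n => \sum_(i < n) a i * bpoly 1 h i) v.
Proof.
move=> a0 h1; apply: (@cvgK_series (fun i => a i * bpoly 1 h i)).
apply: cvgK0_le a0 => [|i]; first exact: ltW p_gt0.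
by rewrite absM mulrC ler_wpM2r // abs_bpoly_le ?abs1.
Qed.

(** For fixed k the error of every partial sum is at most C p p^(-k), whatever its length. This
    bound passes to the full series, and only then does k tend to infinity. *)
Lemma volkenborn_series (a : nat -> K) (F : K -> K) h (v : K) :
  cvgK abs a 0 -> abs h <= 1 ->
  (forall y, abs y <= 1 -> cvgK abs (fun n => \sum_(i < n) a i * y ^+ i) (F y)) ->
  cvgK abs (fun n => \sum_(i < n) a i * bpoly 1 h i) v ->
  cvgK abs (fun k => p%:R ^- k * \sum_(0 <= m < p ^ k) F (h + m%:R)) v.
Proof.
move=> a0 h1 aF av; have [C C0 aC] := cvgK0_bounded _ a0.
apply/cvgKBP/(cvgK_shift 1).
apply: (@cvgK0_le (fun k => p%:R ^+ k) _ (C * p%:R)) cvgK_pX => [|k].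
  by rewrite mulr_ge0 ?ltW.
rewrite addn1 abs_pX -[X in abs X]subr0.
pose u n := p%:R ^- k.+1 * (\sum_(0 <= m < p ^ k.+1) \sum_(i < n) a i * (h + m%:R) ^+ i)
  - \sum_(i < n) a i * bpoly 1 h i.
apply: (@cvgK_abs_le u _ _ _ 0) => [n _|].
  rewrite subr0 /u exchange_big mulr_sumr -sumrB; apply: abs_sum_le => [|i _].
    by rewrite !mulr_ge0 ?invr_ge0 ?exprn_ge0 // ltW.
  rewrite -mulr_sumr mulrCA -mulrBr -mulrA; apply: absM_le => //.
  exact: abs_mean_shift_le.
apply: cvgKB => //; apply: cvgKMl; apply: cvgK_sum => m.
by apply: aF; rewrite abs_leD // abs_nat_le1.
Qed.

Lemma abs_bpoly_taylor_le h e n : abs h <= 1 -> abs e <= 1 ->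
  abs (bpoly 1 (h + e) n.+1 - bpoly 1 h n.+1 - e * (n.+1%:R * bpoly 1 h n))
  <= p%:R * abs e ^+ 2.
Proof.
move=> h1 e1; rewrite bpolyD 2!big_ord_recl /= /bump /= ?add1n.
rewrite bin0 bin1 subn0 subn1 /= expr0 expr1 !mul1r.
set A := bpoly 1 h n.+1; set B := bpoly 1 h n; set S := (X in A + (_ + X)).
have -> : A + (n.+1%:R * e * B + S) - A - e * (n.+1%:R * B) = S by ring.
rewrite [leRHS]mulrC; apply: abs_sum_le => [|i _]; first by rewrite mulr_ge0 ?exprn_ge0 ?abs_ge0 ?ltW.
rewrite -mulrA absM_le1 ?abs_nat_le1 //.
apply: absM_le; last by rewrite abs_bpoly_le ?abs1.
by rewrite absX addnA exprD ler_piMr ?exprn_ge0 ?exprn_ile1.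
Qed.

Lemma bpoly_series_taylor (a : nat -> K) (C : R) h e (v w d : K) :
  (forall n, abs (a n) <= C) -> abs h <= 1 -> abs e <= 1 ->
  cvgK abs (fun n => \sum_(i < n) a i * bpoly 1 h i) v ->
  cvgK abs (fun n => \sum_(i < n) a i * bpoly 1 (h + e) i) w ->
  cvgK abs (fun n => \sum_(i < n) i.+1%:R * a i.+1 * bpoly 1 h i) d ->
  abs (w - v - e * d) <= C * p%:R * abs e ^+ 2.
Proof.
move=> aC h1 e1 av aw ad; have C0 := le_trans (abs_ge0 _) (aC 0).
rewrite -[X in abs X]subr0.
pose u n := \sum_(i < n.+1) a i * bpoly 1 (h + e) i - \sum_(i < n.+1) a i * bpoly 1 h i
  - e * \sum_(i < n) i.+1%:R * a i.+1 * bpoly 1 h i.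
apply: (@cvgK_abs_le u _ _ _ 0) => [n _|].
  rewrite subr0 /u -sumrB big_ord_recl /= !(bpoly0 K Cp_char0) subrr add0r mulr_sumr -sumrB.
  apply: abs_sum_le => [|i _]; first by rewrite mulr_ge0 ?exprn_ge0 ?abs_ge0 // mulr_ge0 // ltW.
  rewrite /bump /= !add1n.
  set x := bpoly _ _ _; set y := bpoly _ _ _; set z := bpoly _ _ _.
  have -> : a i.+1 * x - a i.+1 * y - e * (i.+1%:R * a i.+1 * z)
      = a i.+1 * (x - y - e * (i.+1%:R * z)) by ring.
  by rewrite -mulrA absM_le ?abs_bpoly_taylor_le.
apply: cvgKB; last exact: cvgKMl.

apply: cvgK_eventually 0 _ ((cvgK_shift 1 _ _).2 (cvgKB _ _ _ _ aw av)) => n _.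
by rewrite addn1.
Qed.

(** Termwise differentiation: the remainder after the linear term is O(|e|^2) uniformly, by
    [bpoly_series_taylor]. The result has the same shape as the hypothesis, so the lemma can be
    applied again to the derivative. *)
Lemma derivK_bpoly_series (G : K -> K) x0 (a : nat -> K) h :
  cvgK abs a 0 -> abs h <= 1 ->
  (forall h, abs h <= 1 ->
     cvgK abs (fun n => \sum_(i < n) a i * bpoly 1 h i) (G (x0 + h))) ->
  cvgK abs (fun n => \sum_(i < n) i.+1%:R * a i.+1 * bpoly 1 h i)
    (derivK abs G (x0 + h)).
Proof.
move=> a0 h1 aG; have [C C0 aC] := cvgK0_bounded _ a0.
have a'0 : cvgK abs (fun i => i.+1%:R * a i.+1) 0.
  have a1 := (cvgK_shift 1 _ _).2 a0; apply: (cvgK0_le _ _ 1 _ _ a1) => // n.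
  by rewrite mul1r addn1 absM_le1 ?abs_nat_le1.
have [d ad] := cvgK_bpoly_series _ h a'0 h1.
rewrite (derivKE _ _ d) // => eps eps0; pose D := C * p%:R + 1.
have D0 : 0 < D by rewrite ltr_wpDl // mulr_ge0 ?ltW.
exists (Num.min 1 (eps / D)); first by rewrite lt_min ltr01 divr_gt0.
move=> y yx; rewrite lt_min ltr_pdivlMr // => /andP[y1 yD].
have yx0 : y - (x0 + h) != 0 by rewrite subr_eq0.
set e := y - (x0 + h) in yx0 y1 yD *.
have yE : y = x0 + (h + e) by rewrite /e addrA addrC subrK.
have := bpoly_series_taylor a C h e _ _ _ aC h1 (ltW y1) (aG _ h1) _ ad.
move=> /(_ (G y)); rewrite {1}yE => /(_ (aG _ (abs_leD _ _ _ h1 (ltW y1)))) le_e.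
have -> : (G y - G (x0 + h)) / e - d = (G y - G (x0 + h) - e * d) / e.
  by rewrite [RHS]mulrBl [e * d]mulrC mulfK.
rewrite absM absV ltr_pdivrMr ?abs_gt0 // (le_lt_trans le_e) // expr2 mulrA.
rewrite ltr_pM2r ?abs_gt0 // (le_lt_trans _ yD) // mulrC ler_wpM2l // lerDl //.
Qed.

Lemma series_cvgK_term u l : cvgK abs (fun n => \sum_(i < n) u i) l -> cvgK abs u 0.
Proof.
move=> ul; rewrite -(subrr l).
apply: cvgK_eventually 0 _ (cvgKB _ _ _ _ ((cvgK_shift 1 _ _).2 ul) ul) => n _.
by rewrite addn1 big_ord_recr addrAC subrr add0r.
Qed.

(** * Roots of unity *)

(** For k+1 the root is a zero of the cyclotomic polynomial 1 + Y + ... + Y^(p-1) at Y = X^(p^k).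
    [Cp_Qpbar_closed] applies once its coefficients 0 and 1 are known to lie in [Qpbar]. *)
Lemma primitive_root_pX k : exists z : K, (p ^ k).-primitive_root z.
Proof.
case: k => [|k].
  exists 1; have [m m1 /=] := @prim_order_exists K 1 1 isT (expr1n _ _).
  by rewrite dvdn1 expn0 => /eqP <-.
have Qpbar_nat n : Qpbar abs (n%:R : K).
  exists ('X - n%:R%:P); split; [by rewrite polyXsubC_eq0|move=> i e e0|by rewrite root_XsubC].
  rewrite coefB coefX coefC.
  exists ((i == 1)%:Z - (if i == 0 then n else 0)%:Z)%:~R.
  rewrite ratr_int rmorphB /= !pmulrn.
  by case: (i == 0); rewrite subrr abs0.
pose Q : {poly K} := \poly_(i < p) 1.
have sQ : size Q = p by rewrite size_poly_eq // oner_neq0.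
have [||z _ Pz] := Cp_Qpbar_closed KCp (P := Q \Po 'X^(p ^ k)).
- have: (0 < (size (Q \Po 'X^(p ^ k))).-1)%N.
    rewrite size_comp_poly sQ size_polyXn /= muln_gt0 expn_gt0 (prime_gt0 p_prime) andbT.
    by rewrite -subn1 subn_gt0 prime_gt1.
  by case: (size _) => [|[]].
- move=> i; rewrite coef_comp_poly_Xn ?expn_gt0 ?prime_gt0 //.
  case: ifP => _; last exact: (Qpbar_nat 0).
  by rewrite coef_poly; case: ifP => _; [exact: (Qpbar_nat 1)|exact: (Qpbar_nat 0)].
pose w := z ^+ (p ^ k).
have Qw : \sum_(i < p) w ^+ i = 0.
  move/rootP: Pz; rewrite horner_comp hornerXn horner_poly -/w => Q0; rewrite -[RHS]Q0.
  by apply: eq_bigr => i _; rewrite mul1r.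
have wp : z ^+ (p ^ k.+1) = 1.
  by apply/eqP; rewrite -subr_eq0 expnSr exprM -/w subrX1 Qw mulr0.
(* If w were 1, the sum would be p, which is nonzero. So the order of z divides p^(k+1) but not
   p^k. *)
have w1 : w != 1.
  apply: contra_eqN Qw => /eqP ->; under eq_bigr do rewrite expr1n.
  by rewrite sumr_const card_ord p_neq0.
have pk0 : (0 < p ^ k.+1)%N by rewrite expn_gt0 prime_gt0.
have [m zm /(dvdn_pfactor _ _ p_prime)[j lejk m_eq]] := prim_order_exists pk0 wp.
exists z; move: lejk; rewrite leq_eqVlt => /predU1P[jE|]; first by rewrite -jE -m_eq.
rewrite ltnS => lejk; case/negP: w1; rewrite -(prim_order_dvd zm) m_eq.
by rewrite dvdn_exp2l.
Qed.

Lemma sum_enum (T : choiceType) n (g : nat -> T) (A : set T) (F : T -> K) :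
  (forall i j, (i < n)%N -> (j < n)%N -> g i = g j -> i = j) ->
  (forall x : T, A x <-> exists2 i, (i < n)%N & x = g i) ->
  \sum_(x \in A) F x = \sum_(i < n) F (g i).
Proof.
move=> g_inj gA; rewrite -(big_mkord xpredT (F \o g)) -(big_map g xpredT F) [RHS]fsbig_seq.
  apply: eq_fsbigl; apply/seteqP; split=> x /=.
    by move=> /gA[i lt_in ->]; rewrite map_f // mem_index_iota.
  by case/mapP=> i; rewrite mem_index_iota => /= lt_in ->; apply/gA; exists i.
rewrite map_inj_in_uniq ?iota_uniq // => i j.
by rewrite !mem_index_iota; apply: g_inj.
Qed.

Lemma sum_unity_roots n (z : K) (F : K -> K) : n.-primitive_root z ->
  \sum_(x \in [set x : K | x ^+ n = 1]) F x = \sum_(i < n) F (z ^+ i).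
Proof.
move=> zn; apply: (sum_enum _ _ (fun i => z ^+ i)) => [i j lt_in lt_jn /eqP|x /=].
  by rewrite (eq_prim_root_expr zn) !modn_small // => /eqP.
split=> [/(prim_rootP zn)[i ->]|[i _ ->]]; first by exists i.
by rewrite exprAC (prim_expr_order zn) expr1n.
Qed.

Lemma primitive_root_neq0 (F : fieldType) n (z : F) : n.-primitive_root z -> z != 0.
Proof.
move=> zn; apply: contra_eq_neq (prim_expr_order zn) => ->.
by rewrite expr0n gtn_eqF ?(prim_order_gt0 zn) // eq_sym oner_neq0.
Qed.

Lemma sum_primitive_root n (z : K) i m : n.-primitive_root z -> (i < n)%N -> (m < n)%N ->
  \sum_(a < n) (z ^+ a) ^+ i * (z ^+ a) ^- m = n%:R * (i == m)%:R.
Proof.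
move=> zn lt_in lt_mn; have z0 : z != 0 := primitive_root_neq0 _ _ _ zn.
under eq_bigr => a _ do rewrite -!exprM !(mulnC a) !exprM -expr_div_n.
have [->|neq_im] := eqVneq i m.
  under eq_bigr do rewrite divff ?expf_neq0 // expr1n.
  by rewrite sumr_const card_ord mulr1.
rewrite mulr0; apply/eqP; have: z ^+ i / z ^+ m - 1 != 0.
  rewrite subr_eq0 -(divff (expf_neq0 m z0)) (inj_eq (mulIf _)) ?invr_neq0 ?expf_neq0 //.
  by rewrite (eq_prim_root_expr zn) !modn_small.
move/mulfI/inj_eq => <-; rewrite mulr0 -subrX1 expr_div_n -!exprM !(mulnC _ n) !exprM.
by rewrite (prim_expr_order zn) !expr1n divr1 subrr.
Qed.

Lemma abs_unity_root n (z : K) : (0 < n)%N -> z ^+ n = 1 -> abs z = 1.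
Proof.
move=> n0 zn; apply/eqP; rewrite -(pexpr_eq1 n0) ?abs_ge0 //.
by rewrite -absX zn abs1.
Qed.

Lemma bpoly_expand a b n :
  bpoly a b n = \sum_(i < n.+1) 'C(n, i)%:R * b ^+ (n - i) * (a ^+ i * bern i) :> K.
Proof.
rewrite -[b in LHS]add0r bpolyDr; apply: eq_bigr => i _; congr (_ * _).
by rewrite bpoly_bern // big_ord_recl /= big1 => [|m _];
  rewrite ?expr0 ?bin0 ?subn0 ?expr0n ?mulr0 ?mul0r ?mul1r ?addr0.
Qed.

(** Equivalently p^k p^(-p^k) <= p^(-k): the tail of the trigamma series outweighs the division by
    p^k in the arc integral. *)
Lemma double_leq_pX k : (k.*2 <= p ^ k)%N.
Proof.
have p2 := prime_gt1 p_prime; elim: k => // -[|k] IHk; first by rewrite expn1.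
rewrite doubleS expnS (leq_trans _ (leq_mul p2 IHk)) //.
by rewrite !doubleS mul2n; lia.
Qed.

(** Expanding (w - 1)^j at x = w / p gives powers w^(i-m) with i <= j. Truncation at m < p^k,
    together with j < p^k, turns the congruence i = m mod p^k into equality, so exactly one m
    survives for each i. *)
Lemma arc_main_term k j : (j < p ^ k)%N ->
  p%:R ^- k * \sum_(zeta \in [set z : K | z ^+ (p ^ k) = 1])
    (zeta / p%:R * ((zeta / p%:R - p%:R^-1) ^+ j *
       \sum_(m < p ^ k) (-1) ^+ m * (zeta / p%:R) ^- m.+1 * bern m))
  = (- p%:R) ^- j * bpoly p%:R 1 j :> K.
Proof.
move=> lt_j; have [z zn] := primitive_root_pX k; rewrite (sum_unity_roots _ _ _ zn).
have p0 := p_neq0; have z0 : z != 0 := primitive_root_neq0 _ _ _ zn.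
pose c (i m : nat) : K := 'C(j, i)%:R * (-1) ^+ (j - i) * ((-1) ^+ m * p%:R ^+ m * bern m).
transitivity (p%:R ^- k * \sum_(a < p ^ k) p%:R ^- j * \sum_(m < p ^ k) \sum_(i < j.+1)
    c i m * ((z ^+ a) ^+ i * (z ^+ a) ^- m)).
  congr (_ * _); apply: eq_bigr => a _; have w0 : z ^+ a != 0 by rewrite expf_neq0.
  move: (z ^+ a) w0 => w w0; rewrite !mulr_sumr; apply: eq_bigr => m _.
  rewrite -[X in _ - X]mul1r -mulrBl expr_div_n addrC exprDn !mulr_suml !mulr_sumr.
  apply: eq_bigr => i _; rewrite /c -[_ *+ 'C(j, i)]mulr_natl !expr_div_n.
  rewrite (exprS w m) (exprS p%:R m).
  have wm := expf_neq0 m w0; have pm := expf_neq0 m p0; have pj := expf_neq0 j p0.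
  move: (p%:R ^+ m) (p%:R ^+ j) (w ^+ m) pm pj wm => pm pj wm pm0 pj0 wm0.
  by field; rewrite pm0 pj0 wm0 p0 w0.
rewrite -mulr_sumr exchange_big /=.
under [in LHS]eq_bigr => m _.
  rewrite exchange_big /=; under eq_bigr => i _.
    rewrite -mulr_sumr (sum_primitive_root _ _ _ _ zn) ?(leq_trans (ltn_ord i)) //.
    over.
  over.
rewrite exchange_big bpoly_expand exprNn invrM ?unitfE ?expf_neq0 ?oppr_eq0 ?oner_neq0 //.
rewrite -mulrA; rewrite mulrCA; congr (_ * _); rewrite !mulr_sumr.
apply: eq_bigr => -[i lei] _ /=.
rewrite (bigD1 (Ordinal (leq_trans lei lt_j))) //= eqxx mulr1 big1 ?addr0.
  rewrite natrX /c expr1n mulr1.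
  have -> : (-1) ^- j = (-1) ^+ (j - i) * (-1) ^+ i :> K.
    by rewrite -exprD subnK // -exprVn invrN1.
  have pk := expf_neq0 k p0; move: (p%:R ^+ k) pk => pk pk0.
  by field.
by move=> m; rewrite -val_eqE /= eq_sym => /negPf ->; rewrite !mulr0.
Qed.

(** * The p-adic trigamma function *)

Section LogGamma.
Variable log : K -> K.
Hypothesis log_iwasawa : is_iwasawa_log abs p log.

Lemma log_series x : abs x < 1 ->
  cvgK abs (fun n => \sum_(i < n) (-1) ^+ i * x ^+ i.+1 / i.+1%:R) (log (1 + x)).
Proof.
case: log_iwasawa => _ _ logS /logS /(cvgK_shift 1 _ _).2.
apply: cvgK_eventually 0 _ => n _.
rewrite addn1 big_add1 big_mkord; apply: eq_bigr => i _.
by rewrite -(addn2 i) exprD sqrrN expr1n mulr1.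
Qed.

(** Taylor coefficients at x of the summand z log z - z of Diamond's function. *)
Definition logGamma_coef x i : K :=
  match i with
  | 0 => x * log x - x
  | 1 => log x
  | i.+2 => (-1) ^+ i * x ^- i.+1 / (i.+2%:R * i.+1%:R)
  end.

(* With t = y / x, the partial sums of the series of (1 + t) log (1 + t) - t
   are obtained from those of log (1 + t) by the identity [E] below. *)
Lemma xlogx_series x y : 1 < abs x -> abs y <= 1 ->
  cvgK abs (fun n => \sum_(i < n) logGamma_coef x i * y ^+ i)
    ((x + y) * log (x + y) - (x + y)).
Proof.
move=> x1 y1; have x0 : x != 0 by apply: contraTneq x1 => ->; rewrite abs0 ltr10.
pose t := y / x; have yE : y = x * t by rewrite /t mulrCA divff ?mulr1.
have t1 : abs t < 1.
  by rewrite absM absV ltr_pdivrMr ?abs_gt0 // mul1r (le_lt_trans y1).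
have t0 : 1 + t != 0.
  apply: contraTneq t1 => /eqP; rewrite addrC addr_eq0 => /eqP ->.
  by rewrite absN abs1 ltxx.
have logxy : log (x + y) = log x + log (1 + t).
  by case: log_iwasawa => <- // _ _; rewrite mulrDr mulr1 -yE.
have logt := log_series t t1.
have logt0 := series_cvgK_term (fun i => (-1) ^+ i * t ^+ i.+1 / i.+1%:R) _ logt.
apply/(cvgK_shift 2).
pose S n := \sum_(i < n) (-1) ^+ i * t ^+ i.+1 / i.+1%:R.
have E n : \sum_(i < n) (-1) ^+ i * t ^+ i.+2 / (i.+2%:R * i.+1%:R)
    = (1 + t) * S n - t + (-1) ^+ n * t ^+ n.+1 / n.+1%:R.
  rewrite /S; elim: n => [|n IHn].
    by rewrite !big_ord0 expr0 expr1 mulr0 divr1 mul1r sub0r addNr.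
  rewrite !big_ord_recr /= {}IHn; move: (\sum_(i < n) _) => s.
  rewrite [t ^+ n.+2]exprS [t ^+ n.+1]exprS [(-1) ^+ n.+1]exprS.
  rewrite -[n.+2%:R]nat1r; have := (Cp_char0 n.+1); rewrite -[n.+2%:R]nat1r.
  move: (n.+1%:R : K) (Cp_char0 n) => a a0 a1.
  by field; rewrite a0 a1.
have lim : cvgK abs (fun n => x * log x - x + log x * y + x * (
    (1 + t) * S n - t + (-1) ^+ n * t ^+ n.+1 / n.+1%:R))
    (x * log x - x + log x * y + x * ((1 + t) * log (1 + t) - t + 0)).
  apply: cvgKD (cvgK_cst _) (cvgKMl _ _ _ (cvgKD _ _ _ _ (cvgKB _ _ _ _ _ (cvgK_cst _)) logt0)).
  exact: cvgKMl.
have -> : (x + y) * log (x + y) - (x + y)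
    = x * log x - x + log x * y + x * ((1 + t) * log (1 + t) - t + 0).
  by rewrite logxy yE; ring.
apply: cvgK_eventually 0 _ lim => n _; rewrite -E addn2.
rewrite 2!big_ord_recl expr0 mulr1 expr1 -addrA; congr (_ + (_ + _)).
rewrite mulr_sumr; apply: eq_bigr => i _; rewrite /= /bump !leq0n /= !add1n.
rewrite !add0n yE [(x * t) ^+ _]exprMn [x ^+ i.+2]exprS.
have xi0 := expf_neq0 i.+1 x0; have a0 := Cp_char0 i; have a1 := Cp_char0 i.+1.
move: (x ^+ i.+1) (i.+1%:R : K) (i.+2%:R : K) xi0 a0 a1 => X a b X0 a0 b0.
by field; rewrite X0 a0 b0.
Qed.

Lemma logGamma_coef_cvg0 x : 1 < abs x -> cvgK abs (logGamma_coef x) 0.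
Proof.
move=> x1; have := xlogx_series x 1 x1; rewrite abs1 lexx => /(_ isT) S.
apply: series_cvgK_term; apply: cvgK_eventually 0 _ S => n _.
by apply: eq_bigr => i _; rewrite expr1n mulr1.
Qed.

Lemma logGamma_series x h : 1 < abs x -> abs h <= 1 ->
  cvgK abs (fun n => \sum_(i < n) logGamma_coef x i * bpoly 1 h i)
    (diamond_logGamma abs p log (x + h)).
Proof.
move=> x1 h1; have a0 := logGamma_coef_cvg0 x x1.
have [v av] := cvgK_bpoly_series _ h a0 h1.
rewrite /diamond_logGamma (limKE _ v) //.
have := volkenborn_series _ (fun y => (x + y) * log (x + y) - (x + y)) h v a0 h1
  (fun y => xlogx_series x y x1) av.
apply: cvgK_eventually 0 _ => k _; congr (_ * _).
by apply: eq_bigr => m _; rewrite addrA.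
Qed.

(** Differentiating twice shifts the coefficients by two and multiplies them by (i+2)(i+1), which
    cancels the denominators of [logGamma_coef]; at h = 0 the B_i(h) become Bernoulli numbers. *)
Lemma trigamma_series x : 1 < abs x ->
  cvgK abs (fun n => \sum_(i < n) (-1) ^+ i * x ^- i.+1 * bern i)
    (derivK abs (psi abs p log) x).
Proof.
move=> x1; have a0 := logGamma_coef_cvg0 x x1.
pose b i := i.+1%:R * logGamma_coef x i.+1.
have b0 : cvgK abs b 0.
  have a1 := (cvgK_shift 1 _ _).2 a0; apply: (cvgK0_le _ _ 1 _ _ a1) => // n.
  by rewrite mul1r addn1 absM_le1 ?abs_nat_le1.
(* The first derivative is needed on the whole unit ball around x, since it is differentiated
   again. *)
have psiE h : abs h <= 1 ->
    cvgK abs (fun n => \sum_(i < n) b i * bpoly 1 h i) (psi abs p log (x + h)).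
  move=> h1; apply: derivK_bpoly_series => // h' h'1; exact: logGamma_series.
have := derivK_bpoly_series _ x b 0 b0 _ psiE; rewrite abs0 ler01 addr0 => /(_ isT).
apply: cvgK_eventually 0 _ => n _; apply: eq_bigr => i _; rewrite bpoly10 /b /=.
congr (_ * _); move: (Cp_char0 i) (Cp_char0 i.+1) (x ^- i.+1).
by move: (i.+1%:R : K) (i.+2%:R : K) => c d c0 d0 X; field; rewrite c0.
Qed.

Lemma trigamma_remainder x n : 1 < abs x ->
  abs (derivK abs (psi abs p log) x - \sum_(i < n) (-1) ^+ i * x ^- i.+1 * bern i)
  <= p%:R * abs x ^- n.
Proof.
move=> x1; apply: (cvgK_abs_le _ _ _ _ n _ (trigamma_series x x1)) => m nm.
have x0 : 0 < abs x by apply: lt_trans x1.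
pose f i := (-1) ^+ i * x ^- i.+1 * bern i.
rewrite -!(big_mkord xpredT f) (big_cat_nat (leq0n n) nm) //= [X in X - _]addrC addrK.
rewrite big_nat_cond; apply: abs_sum_le => [|i].
  by rewrite mulr_ge0 ?invr_ge0 ?exprn_ge0 ?ltW.
rewrite andbT => /andP[ni _]; rewrite /f -mulrA absM_le1 ?absX_le1 ?absN ?abs1 //.
rewrite [leRHS]mulrC absM_le ?abs_bern_le // absV absX.
by rewrite lef_pV2 ?posrE ?exprn_gt0 // ler_weXn2l ?ltW // ltnW.
Qed.

Lemma trigamma_arc_integral j :
  is_arc_integral abs p 0 p%:R^-1
    (fun x => (x - p%:R^-1) ^+ j * derivK abs (psi abs p log) x)
    ((- p%:R) ^- j * bpoly p%:R 1 j).
Proof.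
(* The shift ensures j < p^k, as [arc_main_term] requires. *)
apply/cvgKBP/(cvgK_shift j.+1).
(* The factors bound |x|, |x - 1/p|^j and the constant of [trigamma_remainder]. *)
pose C : R := p%:R * (p%:R ^+ j * p%:R).
have C0 : 0 <= C by rewrite !mulr_ge0 ?exprn_ge0 // ltW.
apply: (cvgK0_le _ _ C _ _ ((cvgK_shift j.+1 _ _).2 cvgK_pX)) => // n.
set k := (n + j.+1)%N.
have lt_jk : (j < p ^ k)%N.
  by rewrite (leq_trans _ (ltnW (ltn_expl k (prime_gt1 p_prime)))) // leq_addl.
rewrite -(arc_main_term k j lt_jk) -mulrBr.
have [z zn] := primitive_root_pX k; rewrite !(sum_unity_roots _ _ _ zn) -sumrB.
under eq_bigr => i _ do rewrite /= !subr0 add0r [p%:R^-1 * _]mulrC -!mulrBr.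
rewrite absM absV abs_pX invrK.
have: abs (\sum_(i < p ^ k) (z ^+ i / p%:R * ((z ^+ i / p%:R - p%:R^-1) ^+ j *
    (derivK abs (psi abs p log) (z ^+ i / p%:R) -
  \sum_(m < p ^ k) (-1) ^+ m * (z ^+ i / p%:R) ^- m.+1 * bern m))))
    <= C * p%:R ^- (p ^ k).
  apply: abs_sum_le => [|i _]; first by rewrite mulr_ge0 // invr_ge0 exprn_ge0 ?ltW.
  have zi : abs (z ^+ i) = 1.
    by rewrite absX (abs_unity_root _ _ _ (prim_expr_order zn)) ?expr1n ?expn_gt0 ?prime_gt0.
  have absx : abs (z ^+ i / p%:R) = p%:R by rewrite absM zi mul1r absV (Cp_absp KCp) invrK.
  have -> : C * p%:R ^- (p ^ k) = p%:R * (p%:R ^+ j * (p%:R * p%:R ^- (p ^ k))).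
    by rewrite /C -!mulrA.
  apply: absM_le; first by rewrite absx.
  apply: absM_le.
    rewrite absX lerXn2r ?nnegrE ?abs_ge0 ?(ltW p_gt0) // abs_leD ?absx // absN absV.
    by rewrite (Cp_absp KCp) invrK.
  by rewrite -{2}absx trigamma_remainder // absx.
move=> le_sum; rewrite (le_trans (ler_wpM2l _ le_sum)) ?exprn_ge0 ?(ltW p_gt0) //.
rewrite mulrCA ler_wpM2l // ler_pdivrMr ?exprn_gt0 // mulrC ler_pdivlMr ?exprn_gt0 //.
by rewrite -exprD addnn ler_weXn2l ?(ltW p_gt1) ?double_leq_pX.
Qed.

End LogGamma.

(** * Dirichlet characters mod p and L-values *)

Section Characters.
Variable omega : {ffun 'F_p -> K}.
Hypothesis omega_teich : is_teichmuller abs omega.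

Let dirichlet_omega : dirichlet omega. Proof. by case: omega_teich. Qed.

Lemma dirichletX (chi : {ffun 'F_p -> K}) a n : dirichlet chi -> chi (a ^+ n) = chi a ^+ n.
Proof.
by case=> _ chi1 chiM; elim: n => [|n IHn]; rewrite ?chi1 // !exprS chiM IHn.
Qed.

Lemma Fp_nat_eq0 n : (n%:R == 0 :> 'F_p) = (p %| n)%N.
Proof. by rewrite -(dvdn_pcharf (pchar_Fp p_prime)). Qed.

Lemma Fp_val_nat (a : 'F_p) : (a : nat)%:R = a.
Proof. exact: natr_Zp. Qed.

Lemma Fp_expf_pred (a : 'F_p) : a != 0 -> a ^+ p.-1 = 1.
Proof.
move=> a0; apply: (mulfI a0); rewrite -exprS prednK ?prime_gt0 // mulr1.
by have := finfield.expf_card a; rewrite card_Fp.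
Qed.

Lemma dirichlet_expf_pred (chi : {ffun 'F_p -> K}) a :
  dirichlet chi -> a != 0 -> chi a ^+ p.-1 = 1.
Proof. by move=> D a0; rewrite -dirichletX // Fp_expf_pred //; case: D. Qed.

Lemma pred_p_gt0 : (0 < p.-1)%N.
Proof. by rewrite -subn1 subn_gt0 prime_gt1. Qed.

Lemma Fp_primitive_root : exists g : 'F_p, p.-1.-primitive_root g.
Proof.
have := @cyclic.has_prim_root 'F_p p.-1 [seq x <- enum 'F_p | x != 0] pred_p_gt0.
case/(_ _ _ _)/hasP => [|||g _ g_prim]; last by exists g.
- by apply/allP=> x; rewrite mem_filter unity_rootE => /andP[/Fp_expf_pred ->].
- by rewrite filter_uniq ?enum_uniq.
have := size_rem (mem_enum 'F_p 0); rewrite -cardE card_Fp // => <-.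
by rewrite rem_filter ?enum_uniq.
Qed.

(** [omega a] is within distance less than 1 of the representative of a; if it equals 1, then p
    divides that representative minus 1. *)
Lemma teichmuller_eq1 a : a != 0 -> omega a = 1 -> a = 1.
Proof.
move=> a0 oa1; have [_ /(_ a)] := omega_teich.
rewrite -Fp_nat_eq0 Fp_val_nat a0 => /(_ isT); rewrite oa1 => lt1.
apply/eqP; rewrite -subr_eq0 -[a]Fp_val_nat.
have a_gt0 : (0 < (a : nat))%N.
  by rewrite lt0n; apply: contra a0 => /eqP a_0; apply/eqP/val_inj.
rewrite -[1]/(1%:R) -natrB // Fp_nat_eq0; apply: contraLR lt1 => /abs_coprime.
by rewrite absB natrB // => ->; rewrite ltxx.
Qed.

Lemma teichmuller_primitive_root (g : 'F_p) :
  p.-1.-primitive_root g -> p.-1.-primitive_root (omega g).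
Proof.
move=> g_prim; have g0 := primitive_root_neq0 _ _ _ g_prim.
have og := dirichlet_expf_pred omega g dirichlet_omega g0.
have [m og_prim /dvdn_leq] := prim_order_exists pred_p_gt0 og.
move=> /(_ pred_p_gt0) le_m; suff <- : m = p.-1 by [].
apply/eqP; rewrite eqn_leq le_m; apply: dvdn_leq; first exact: prim_order_gt0 og_prim.
rewrite (prim_order_dvd g_prim); apply/eqP/teichmuller_eq1; first by rewrite expf_neq0.
by rewrite dirichletX // (prim_expr_order og_prim).
Qed.

(** The case a = 0 is separate because of i = 0: [0 ^+ 0] is 1, while the principal character
    vanishes at 0. *)
Definition teichmuller_char (i : nat) : {ffun 'F_p -> K} :=
  [ffun a => if a == 0 then 0 else omega a ^+ i].

Lemma teichmuller_char_inj i j : (i < p.-1)%N -> (j < p.-1)%N ->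
  teichmuller_char i = teichmuller_char j -> i = j.
Proof.
move=> lt_i lt_j /ffunP; have [g g_prim] := Fp_primitive_root.
move=> /(_ g); rewrite !ffunE (negPf (primitive_root_neq0 _ _ _ g_prim)) => /eqP.
by rewrite (eq_prim_root_expr (teichmuller_primitive_root g g_prim)) !modn_small // => /eqP.
Qed.

Lemma teichmuller_char0 : teichmuller_char 0 = principal K p.
Proof. by apply/ffunP => a; rewrite !ffunE expr0; case: eqP. Qed.

(** A character is determined by its value at a generator g, a (p-1)-th root of unity, hence a power
    of the primitive root [omega g]. *)
Lemma dirichletP (chi : {ffun 'F_p -> K}) :
  dirichlet chi <-> exists2 i, (i < p.-1)%N & chi = teichmuller_char i.
Proof.
have [_ omega1 omegaM] := dirichlet_omega.
split=> [D|[i _ ->]]; last first.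
  split=> [||a b]; rewrite !ffunE ?eqxx ?oner_eq0 ?omega1 ?expr1n //.
  by rewrite mulf_eq0; do 2!case: eqP => //= _; rewrite ?mul0r ?mulr0 // omegaM exprMn.
have [g g_prim] := Fp_primitive_root; have g0 := primitive_root_neq0 _ _ _ g_prim.
have [i chig] := prim_rootP (teichmuller_primitive_root g g_prim)
  (dirichlet_expf_pred chi g D g0).
exists i => //; apply/ffunP => a; rewrite ffunE; case: eqP => [->|/eqP a0].
  by case: D.
have [m ->] := prim_rootP g_prim (Fp_expf_pred a a0).
by rewrite !dirichletX // chig exprAC.
Qed.

Lemma sum_dirichlet (F : {ffun 'F_p -> K} -> K) :
  \sum_(chi \in @dirichlet K p) F chi = \sum_(i < p.-1) F (teichmuller_char i).
Proof. by apply: sum_enum => [|chi]; [exact: teichmuller_char_inj|exact: dirichletP]. Qed.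

Lemma sum_teichmuller_char a : a != 0 ->
  \sum_(i < p.-1) teichmuller_char i a = (p.-1)%:R * (a == 1)%:R.
Proof.
move=> a0; under eq_bigr do rewrite ffunE (negPf a0).
have [->|a1] := eqVneq a 1.
  have [_ -> _] := dirichlet_omega; under eq_bigr do rewrite expr1n.
  by rewrite sumr_const card_ord mulr1.
rewrite mulr0; apply/eqP; have: omega a - 1 != 0.
  by rewrite subr_eq0; apply: contra a1 => /eqP/(teichmuller_eq1 a a0) ->.
move/mulfI/inj_eq => <-; rewrite mulr0 -subrX1.
by rewrite (dirichlet_expf_pred omega a dirichlet_omega a0) subrr.
Qed.

(** One formula covers both conductors. For non-principal [xi] the Euler factor is 1 and the term a
    = p is 0. For principal [xi], the modulus-p expression of B_(n+1) has as its term a = p exactly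
    p^n B_(n+1), which the Euler factor removes. *)
Lemma gbern_primitive (xi : {ffun 'F_p -> K}) n : xi 0 = 0 ->
  (1 - primitive xi p * p%:R ^+ n) * gbern (conductor xi) (primitive xi) n.+1
  = p%:R^-1 * \sum_(1 <= a < p) xi a%:R * bpoly p%:R a%:R n.+1.
Proof.
move=> xi0; have p1 := prime_gt0 p_prime.
have -> : \sum_(1 <= a < p) xi a%:R * bpoly p%:R a%:R n.+1
    = \sum_(1 <= a < p) primitive xi a * bpoly p%:R a%:R n.+1.
  apply: eq_big_nat => a /andP[a_gt0 lt_ap]; congr (_ * _); rewrite /primitive.
  case: eqP => // ->; rewrite ffunE Fp_nat_eq0.
  by rewrite gtnNdvd.
rewrite /conductor; case: ifPn => [/eqP xi1|xi1]; last first.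
  rewrite (gbern_bpoly _ Cp_char0) // big_nat_recr //= /primitive (negPf xi1).
  by rewrite (pchar_Fp_0 p_prime) xi0 !mul0r subr0 mul1r addr0.
have xi1E : primitive xi = fun=> 1 by apply/funext => a; rewrite /primitive xi1 eqxx.
rewrite xi1E mul1r mulrBl mul1r -[in X in X - _](gbern1_distribution _ Cp_char0 p) //.
rewrite !(gbern_bpoly _ Cp_char0) // big_nat_recr //= big_nat1 invr1 !mul1r.
have -> : bpoly p%:R p%:R n.+1 = p%:R ^+ n.+1 * bpoly 1 1 n.+1 :> K.
  by rewrite -bpolyZ !mulr1.
by rewrite mulrDr exprS !mulrA mulVf ?p_neq0 // mul1r addrK.
Qed.

(** The expansion of L at 1 must hold on the closed unit disc. Here p has to be odd: for p = 2 the
    exponent is 0 and the radius is 1. *)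
Lemma Lp_radius_gt1 : odd p -> 1 < Lp_radius R p.
Proof.
move=> p_odd; have p3 : (2 < p)%N.
  by rewrite ltn_neqAle prime_gt1 // andbT; apply: contraTneq p_odd => <-.
have ge1 : 1 <= Lp_radius R p.
  rewrite -[leLHS](powRr0 p%:R) ler_powR ?(ltW p_gt1) //.
  by rewrite subr_ge0 invf_le1 ?ltr0n ?ler1n pred_p_gt0.
rewrite lt_neqAle ge1 eq_sym powR_eq1.
rewrite andbT !negb_or -leNgt (ltW p_gt0) gt_eqF //= subr_eq0 eq_sym invr_eq1.
by rewrite pnatr_eq1; case: (p) p3 => [|[|[]]].
Qed.

Lemma Lp_simple_pole (chi : {ffun 'F_p -> K}) (L : K -> K) : odd p ->
  is_Lp abs omega chi L ->
  exists c : K, (c != 0 <-> chi = principal K p) /\ exists2 D : R, 0 < D &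
    forall t, t != 0 -> abs t <= 1 -> abs (t * L (1 - t) + c) <= D * abs t.
Proof.
move=> p_odd [[c [u [c0 uL]]] _]; exists c; split=> //.
have radius s : abs s <= 1 -> abs s < Lp_radius R p.
  by move=> /le_lt_trans -> //; exact: Lp_radius_gt1.
have expand t : t != 0 -> abs t <= 1 ->
    cvgK abs (fun n => c / - t + \sum_(i < n) u i * (- t) ^+ i) (L (1 - t)).
  move=> t0 t1; have := uL (1 - t); rewrite addrAC subrr add0r; apply.
    by apply: radius; rewrite abs_leD ?absN ?abs1.
  by left; rewrite -subr_eq0 addrAC subrr add0r oppr_eq0.
(* Convergence at t = 1, that is at s = 0, bounds the coefficients [u i]. *)
have u0 : cvgK abs (fun i => u i * (- 1) ^+ i) 0.
  have := expand 1 (oner_neq0 K); rewrite abs1 lexx => /(_ isT) S.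
  apply: (series_cvgK_term _ (L (1 - 1) - c / - 1)).
  by apply: cvgK_eventually 0 _ (cvgKB _ _ _ _ S (cvgK_cst (c / - 1))) => n _;
    rewrite addrAC subrr add0r.
have [D D0 uD] := cvgK0_bounded _ u0; exists D => // t t0 t1.
rewrite -ler_pdivrMr ?abs_gt0 // -absV -absM.
have -> : (t * L (1 - t) + c) / t = L (1 - t) - c / - t.
  by rewrite mulrDl [t * _]mulrC mulfK // invrN mulrN opprK.
apply: (cvgK_abs_le _ _ _ _ 0 _ (expand t t0 t1)) => n _.
rewrite addrAC subrr add0r abs_sum_le ?ltW // => i _.
have := uD i; rewrite !absM !absX !absN abs1 expr1n mulr1 => uiD.
by rewrite (le_trans _ uiD) // ler_piMr ?exprn_ile1 ?abs_ge0.
Qed.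

Lemma Lp_neg_value (chi : {ffun 'F_p -> K}) (L : K -> K) n :
  dirichlet chi -> is_Lp abs omega chi L ->
  n.+1%:R * L (1 - n.+1%:R)
  = - (p%:R^-1 * \sum_(1 <= a < p) chi a%:R * omega a%:R ^- n.+1 * bpoly p%:R a%:R n.+1).
Proof.
move=> [chi0 _ _] [_ /(_ n.+1 isT) ->] /=; rewrite mulrC mulfVK ?Cp_char0 // mulNr.
rewrite gbern_primitive; last by rewrite ffunE chi0 mul0r.
by congr (- (_ * _)); apply: eq_bigr => a _; rewrite ffunE.
Qed.

(** The factor n comes out of 'C(n, i+1) = n 'C(n-1, i) / (i+1), and p^(i+1) absorbs the
    denominator. Hence p^n B_n(a/p) approaches a^n as n tends to 0 in K. *)
Lemma abs_bpoly_p_sub_le a n : 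
  abs (bpoly p%:R a%:R n - a%:R ^+ n : K) <= p%:R * abs n%:R.
Proof.
rewrite bpoly_expand big_ord_recl /= subn0 bin0 !mul1r -bpoly10 (bpoly0 _ Cp_char0).
rewrite mulr1 addrAC subrr add0r; apply: abs_sum_le => [|i _].
  by rewrite mulr_ge0 ?abs_ge0 // ltW.
have lt_in := ltn_ord i; rewrite /bump /= add1n.
have -> : 'C(n, i.+1)%:R = n%:R * 'C(n.-1, i)%:R / i.+1%:R :> K.
  by apply: (canRL (mulfK (Cp_char0 i))); rewrite -!natrM mul_bin_diag mulnC.
have reorder (A B C D X : K) : C != 0 -> A * B / C * D * (p%:R ^+ i.+1 * X)
    = A * (B * D * (p%:R * (p%:R ^+ i / C)) * X) by move=> C0; rewrite exprS; field.
rewrite reorder ?Cp_char0 // [leRHS]mulrC absM ler_pM ?abs_ge0 //.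
apply: absM_le1; last exact: abs_bern_le.
apply: absM_le1; last by rewrite absM_le1 ?abs_nat_le1 ?abs_pX_div_le1.
by rewrite absM_le1 ?absX_le1 ?abs_nat_le1.
Qed.

(* The residue is read off the values at 1 - n for n = (p - 1) p^k, where
   omega^(-n) is principal and n tends to 0. *)
Lemma Lp_residue (chi : {ffun 'F_p -> K}) (L : K -> K) : odd p ->
  chi = principal K p -> is_Lp abs omega chi L ->
  exists2 D : R, 0 < D & forall t, t != 0 -> abs t <= 1 ->
    abs (t * L (1 - t) + p.-1%:R / p%:R) <= D * abs t.
Proof.
move=> p_odd chi1 LL; have [c [_ [D D0 cD]]] := Lp_simple_pole chi L p_odd LL.
have Dchi : dirichlet chi.
  by apply/dirichletP; exists 0; rewrite ?pred_p_gt0 // teichmuller_char0.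
suff <- : c = p.-1%:R / p%:R by exists D.
pose C : R := D + p%:R * p%:R.
have C0 : 0 <= C by rewrite addr_ge0 ?mulr_ge0 // ltW.
apply/eqP; rewrite -subr_eq0; apply/eqP.
(* The constant difference is zero because it is at most C p^(-k) for every k. *)
apply: (cvgK_unique (fun=> c - p.-1%:R / p%:R)); first exact: cvgK_cst.
apply: (cvgK0_le _ _ C C0 _ cvgK_pX) => k.
(* Euler's theorem then gives a^n = 1 mod p^(k+1) for each a from 1 to p-1. The p-1 summands of S
   thus tend to 1, and S to (p-1)/p. *)
set n := totient (p ^ k.+1).
have nE : n = (p.-1 * p ^ k)%N by rewrite /n totient_pfactor.
have n0 : (0 < n)%N by rewrite nE muln_gt0 pred_p_gt0 expn_gt0 prime_gt0.
have abs_n : abs n%:R <= abs (p%:R ^+ k) by rewrite abs_pX abs_dvd_le // nE dvdn_mull.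
have nK : n%:R != 0 :> K by rewrite -(prednK n0) Cp_char0.
have := cD n%:R nK (abs_nat_le1 n); rewrite -{1 2}(prednK n0) (Lp_neg_value _ _ _ Dchi LL) prednK //.
set S := p%:R^-1 * _ => le1.
have le2 : abs (S - p.-1%:R / p%:R) <= p%:R * p%:R * abs (p%:R ^+ k).
  have -> : S - p.-1%:R / p%:R
      = p%:R^-1 * \sum_(1 <= a < p) (bpoly p%:R a%:R n - 1).
    rewrite sumrB sumr_const_nat subn1 mulrBr; congr (_ - _); last by rewrite mulrC.
    congr (_ * _); apply: eq_big_nat => a /andP[a_gt0 lt_ap].
    have a0 : a%:R != 0 :> 'F_p by rewrite Fp_nat_eq0 gtnNdvd.
    rewrite chi1 ffunE a0 mul1r nE exprM (dirichlet_expf_pred _ _ dirichlet_omega a0).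
    by rewrite expr1n invr1 mul1r.
  rewrite -mulrA; apply: absM_le; first by rewrite absV (Cp_absp KCp) invrK.
  rewrite big_nat_cond; apply: abs_sum_le => [|a]; first by rewrite mulr_ge0 ?abs_ge0 // ltW.
  rewrite andbT => /andP[a_gt0 lt_ap]; rewrite -(subrK (a%:R ^+ n) (bpoly _ _ _)) -addrA.
  apply: abs_leD.
    by rewrite (le_trans (abs_bpoly_p_sub_le a n)) // ler_wpM2l // ltW.
  have : (a ^ n = 1 %[mod p ^ k.+1])%N.
    apply: cyclic.Euler_exp_totient; rewrite coprimeXr // coprime_sym prime_coprime //.
    by rewrite gtnNdvd.
  move/eqP; rewrite eqn_mod_dvd ?expn_gt0 ?a_gt0 // => /abs_dvd_le.
  rewrite natrB ?expn_gt0 ?a_gt0 // natrX => /le_trans -> //.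
  rewrite abs_pX -{1}[_ ^- _]mul1r ler_pM ?invr_ge0 ?exprn_ge0 ?ler01 ?(ltW p_gt0) ?(ltW p_gt1) //.
  by rewrite lef_pV2 ?posrE ?exprn_gt0 // ler_weXn2l ?(ltW p_gt1).
have -> : c - p.-1%:R / p%:R = (- S + c) + (S - p.-1%:R / p%:R).
  by rewrite addrA addrC addrAC addrA; ring.
have pk0 := abs_ge0 (p%:R ^+ k).
apply: abs_leD.
  apply: (le_trans le1); rewrite ler_pM ?abs_ge0 // ?(ltW D0) // lerDl.
  by rewrite mulr_ge0 // ltW.
by apply: (le_trans le2); rewrite ler_wpM2r // lerDr ltW.
Qed.

(** * The mean of the L-functions over all characters mod p *)

Section Lstar.
Variable L : {ffun 'F_p -> K} -> K -> K.
Hypothesis p_odd : odd p.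
Hypothesis L_kubota_leopoldt : forall chi, dirichlet chi -> is_Lp abs omega chi (L chi).

Let dirichlet_teichmuller_char i : (i < p.-1)%N -> dirichlet (teichmuller_char i).
Proof. by move=> lt_i; apply/dirichletP; exists i. Qed.

(** The factor [omega a%:R ^- j.+1] is the same for all characters, so orthogonality applies
    directly and leaves a = 1. *)
Lemma j_Lp_starS j : j_Lp_star abs L j.+1 = - (p%:R^-1 * bpoly p%:R 1 j.+1).
Proof.
rewrite /j_Lp_star /Lp_star sum_dirichlet mulrCA mulr_sumr.
have value (i : 'I_p.-1) : j.+1%:R * L (teichmuller_char i) (1 - j.+1%:R)
    = - (p%:R^-1 * \sum_(1 <= a < p) teichmuller_char i a%:R *
          (omega a%:R ^- j.+1 * bpoly p%:R a%:R j.+1)).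
  have D := dirichlet_teichmuller_char _ (ltn_ord i).
  rewrite (Lp_neg_value _ _ _ D (L_kubota_leopoldt _ D)).
  by under eq_bigr do rewrite -mulrA.
rewrite (eq_bigr _ (fun i _ => value i)) sumrN -mulr_sumr exchange_big /=.
rewrite big_ltn ?prime_gt1 //= big_nat_cond [X in _ + X]big1 => [|a /andP[/andP[a_gt1 lt_ap] _]].
  have [_ omega1 _] := dirichlet_omega.
  rewrite addr0 -mulr_suml (sum_teichmuller_char 1) ?oner_neq0 // eqxx mulr1.
  rewrite omega1 expr1n invr1 mul1r mulrN; congr (- _).
  rewrite mulrCA mulKf // -(prednK pred_p_gt0); exact: Cp_char0.
rewrite -mulr_suml sum_teichmuller_char; last by rewrite Fp_nat_eq0 gtnNdvd // ltnW.
have /negPf -> : a%:R != 1 :> 'F_p.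
  rewrite -subr_eq0 -[1]/(1%:R) -natrB ?(ltnW a_gt1) // Fp_nat_eq0 gtnNdvd ?subn_gt0 //.
  by rewrite (leq_ltn_trans (leq_subr _ _)).
by rewrite mulr0 mul0r.
Qed.

(** Only the principal character has a pole: its t L(1-t) tends to -(p-1)/p, the others tend to 0,
    and the mean divides by p-1. *)
Lemma j_Lp_star0 : j_Lp_star abs L 0 = - p%:R^-1.
Proof.
have bound (i : 'I_p.-1) : exists D : R, 0 < D /\ forall t, t != 0 -> abs t <= 1 ->
    abs (t * L (teichmuller_char i) (1 - t) + (i == 0 :> nat)%:R * (p.-1%:R / p%:R))
    <= D * abs t.
  have D := dirichlet_teichmuller_char _ (ltn_ord i); have LL := L_kubota_leopoldt _ D.
  case: eqP => [i0|/eqP i0].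
    have [|C C0 LC] := Lp_residue _ _ p_odd _ LL; first by rewrite i0 teichmuller_char0.
    by exists C; split=> // t; rewrite mul1r; apply: LC.
  have [c [c_eq0 [C C0 LC]]] := Lp_simple_pole _ _ p_odd LL.
  exists C; split=> // t t0 t1; rewrite mul0r; have := LC t t0 t1.
  suff -> : c = 0 by [].
  apply/eqP; apply: contraNT i0 => /c_eq0; rewrite -teichmuller_char0.
  by move=> /teichmuller_char_inj -> //; rewrite pred_p_gt0.
have [D DL] := fin_all_exists bound.
pose C : R := 1 + \sum_i D i.
have D_ge0 i : 0 <= D i by have [/ltW] := DL i.
have C0 : 0 < C by rewrite ltr_wpDr // sumr_ge0.
have DC i : D i <= C.
  by rewrite /C (bigD1 i) //= addrCA lerDl addr_ge0 ?ler01 // sumr_ge0.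
have pred_p0 : p.-1%:R != 0 :> K by rewrite -(prednK pred_p_gt0) Cp_char0.
have abs_pred_p : abs p.-1%:R = 1.
  by rewrite abs_coprime // gtnNdvd ?pred_p_gt0 // ltn_predL prime_gt0.
apply: flimKE => e e0; exists (Num.min 1 (e / C)); first by rewrite lt_min ltr01 divr_gt0.
move=> t t0; rewrite subr0 lt_min => /andP[t1 tC].
rewrite /Lp_star sum_dirichlet opprK.
have -> : p%:R^-1 = p.-1%:R^-1 * \sum_(i < p.-1) (i == 0 :> nat)%:R * (p.-1%:R / p%:R) :> K.
  rewrite (bigD1 (Ordinal pred_p_gt0)) //= mul1r big1 ?addr0 ?mulKf // => i.
  by rewrite -val_eqE /= => /negPf ->; rewrite mul0r.
rewrite mulrCA -mulrDr mulr_sumr -big_split absM absV abs_pred_p invr1 mul1r.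
apply: le_lt_trans (_ : C * abs t < e); last by rewrite mulrC -ltr_pdivlMr.
apply: abs_sum_le => [|i _]; first by rewrite mulr_ge0 ?abs_ge0 // ltW.
have [_ /(_ t t0 (ltW t1)) le_i] := DL i.
by rewrite (le_trans le_i) // ler_wpM2r.
Qed.

Lemma j_Lp_star_bpoly j :
  (- p%:R) ^ (1 - j%:Z) * j_Lp_star abs L j = (- p%:R) ^- j * bpoly p%:R 1 j.
Proof.
have p0 : - p%:R != 0 :> K by rewrite oppr_eq0 p_neq0.
have Np : - p%:R * - p%:R^-1 = 1 :> K by rewrite mulrNN divff ?p_neq0.
rewrite expfzDr // -mulrA mulrCA -exprnN; case: j => [|j].
  by rewrite j_Lp_star0 (bpoly0 _ Cp_char0) Np.
rewrite j_Lp_starS -mulNr; congr (_ * _).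
by rewrite expr1z mulrA Np mul1r.
Qed.

End Lstar.
End Characters.

End Cp.

Theorem theorem4p14 (p : nat) (p_prime : prime p) (p_odd : odd p)
  (R : realType) (K : fieldType) (abs : K -> R) (KCp : is_Cp abs p)
  (log : K -> K) (log_iwasawa : is_iwasawa_log abs p log)
  (omega : {ffun 'F_p -> K}) (omega_teich : is_teichmuller abs omega)
  (L : {ffun 'F_p -> K} -> K -> K)
  (L_kubota_leopoldt : forall chi, dirichlet chi -> is_Lp abs omega chi (L chi))
  (j : nat) :
  is_arc_integral abs p 0 (p%:R)^-1
    (fun x => (x - (p%:R)^-1) ^+ j * derivK abs (psi abs p log) x)
    ((- p%:R) ^ (1 - j%:Z) * j_Lp_star abs L j).
Proof.
rewrite (j_Lp_star_bpoly _ _ _ _ p_prime KCp _ omega_teich _ p_odd L_kubota_leopoldt).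
exact: (trigamma_arc_integral _ _ _ _ p_prime KCp _ log_iwasawa).
Qed.
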